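(* Let $\mathrm{Gr}_{\mathbf b}(k,n)$ be a divisive weighted Grassmann orbifold, with $b_i$ dividing $b_{i-1}$ for all $i=1,\dots,m$. Then for all $i,j,\ell\in\{0,\dots,m\}$ the equivariant structure constant ${\bf b}\widetilde{\mathscr C}_{i\,j}^{\ell}$ can be written as a polynomial in $y_r-y_{r+1}$ ($r=1,2,\dots,n-1$) and $(-Y_{\lambda^0})$ whose coefficients are non-negative integers.
   Context: Let $1\le k<n$ and $m+1=\binom nk$. A Schubert symbol for $k<n$ is a sequence $\lambda=(\lambda_1<\dots<\lambda_k)$ of integers in $\{1,\dots,n\}$ (identified with its underlying set). Write $\lambda\preceq\mu$ iff $\lambda_i\le\mu_i$ for all $i$, and fix a total order $\lambda^0<\lambda^1<\dots<\lambda^m$ of all Schubert symbols refining $\preceq$ (so $\lambda^0=(1,\dots,k)$). With $e_1,\dots,e_n$ the standard basis of $\mathbb C^n$ and $e_\lambda=e_{\lambda_1}\wedge\dots\wedge e_{\lambda_k}$, identify $\Lambda^k(\mathbb C^n)$ with $\mathbb C^{m+1}$ by $z=\sum_i z_ie_{\lambda^i}$. Let $Pl(k,n)=\{a_1\wedge\dots\wedge a_k: a_i\in\mathbb C^n\}\setminus\{0\}$. $\mathbf b=(b_0,\dots,b_m)\in(\mathbb Z_{\ge1})^{m+1}$ is a Plücker weight vector if for all $1\le i_1<\dots<i_{k-1}\le n$ and $1\le\ell_0<\dots<\ell_k\le n$ the sum $b_{r_j}+b_{s_j}$ takes the same value for all $j\in\{0,\dots,k\}$ with $\ell_j\notin\{i_1,\dots,i_{k-1}\}$,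 where $\lambda^{r_j}=\{i_1,\dots,i_{k-1},\ell_j\}$ and $\lambda^{s_j}=\{\ell_0,\dots,\ell_k\}\setminus\{\ell_j\}$. For such $\mathbf b$, $\mathbb C^*$ acts on $Pl(k,n)$ by $t(z_0,\dots,z_m)=(t^{b_0}z_0,\dots,t^{b_m}z_m)$, and $\mathrm{Gr}_{\mathbf b}(k,n)$ is the orbit space with the quotient topology (a weighted Grassmann orbifold). A Plücker permutation is a permutation $\sigma$ of $\{0,\dots,m\}$ for which there are signs $t_i\in\{1,-1\}$ such that $(t_0z_{\sigma(0)},\dots,t_mz_{\sigma(m)})\in Pl(k,n)$ for every $z\in Pl(k,n)$; $\mathrm{Gr}_{\mathbf b}(k,n)$ is divisive if for some Plücker permutation $\sigma$, $b_{\sigma(i)}$ divides $b_{\sigma(i-1)}$ for all $i=1,\dots,m$. Up to homeomorphism one assumes (standing convention) that $b_i$ divides $b_{i-1}$ for all $i=1,\dots,m$. Put $d(\lambda)=\sum_{r=1}^k(\lambda_r-r)$. For $s\in\lambda$, $s'\notin\lambda$, $s<s'$, let $(s,s')\lambda$ be the symbol obtained by replacing $s$ by $s'$ in $\lambda$. Let $I(\lambda^i)$ be the set of all $(s,s')\lambda^i$, and $R(\lambda^i)=\{\lambda^j:\lambda^i\in I(\lambda^j)\}$. Put $Y_\lambda=\sum_{r=1}^ky_{\lambda_r}$. $T^n=(S^1)^n$ acts on $\mathrm{Gr}_{\mathbf b}(k,n)$ by $t\cdot[(z_i)]=[(t_{\lambda^i}z_i)]$, $t_\lambda=t_{\lambda_1}\cdots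 t_{\lambda_k}$, and $H^*_{T^n}(\mathrm{pt};\mathbb Z)=\mathbb Z[y_1,\dots,y_n]$. Restriction to the fixed points $[e_{\lambda^j}]$ (written $\alpha|_{\lambda^j}=\alpha_j$) identifies (known) $$H^*_{T^n}(\mathrm{Gr}_{\mathbf b}(k,n);\mathbb Z)=\Big\{\alpha\in\bigoplus_{j=0}^m\mathbb Z[y_1,\dots,y_n]:\ \big(Y_{\lambda^i}-\tfrac{b_i}{b_j}Y_{\lambda^j}\big)\text{ divides }(\alpha_j-\alpha_i)\text{ whenever }\lambda^i\in R(\lambda^j)\Big\}.$$ The equivariant Schubert class ${\bf b}\widetilde{\mathbb S}_{\lambda^i}$ is the unique element with: (1) ${\bf b}\widetilde{\mathbb S}_{\lambda^i}|_{\lambda^j}\ne0\Rightarrow\lambda^j\succeq\lambda^i$; (2) ${\bf b}\widetilde{\mathbb S}_{\lambda^i}|_{\lambda^i}=\prod_{\lambda^\ell\in R(\lambda^i)}(Y_{\lambda^\ell}-\frac{b_\ell}{b_i}Y_{\lambda^i})$; (3) each ${\bf b}\widetilde{\mathbb S}_{\lambda^i}|_{\lambda^j}$ is a homogeneous polynomial in $y_1,\dots,y_n$ of degree $d(\lambda^i)$. These classes form a $\mathbb Z[y_1,\dots,y_n]$-basis, and ${\bf b}\widetilde{\mathscr C}_{i\,j}^{\ell}$ are defined by ${\bf b}\widetilde{\mathbb S}_{\lambda^i}{\bf b}\widetilde{\mathbb S}_{\lambda^j}=\sum_{\ell=0}^m{\bf b}\widetilde{\mathscr C}_{i\,j}^{\ell}\,{\bf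 b}\widetilde{\mathbb S}_{\lambda^\ell}$. *)

(* Defs.v *)
From HB Require Import structures.
From mathcomp Require Import all_boot all_order all_fingroup all_algebra.
From mathcomp Require Import mpoly.
From mathcomp Require Import reals.
From mathcomp Require Import complex.

Set Implicit Arguments.
Unset Strict Implicit.
Unset Printing Implicit Defensive.

Import GRing.Theory Num.Theory.
Local Open Scope ring_scope.

(* Entries live in 'I_n = {0, ..., n-1}, so the integer p of {1, ..., n} is
   the ordinal p-1 and y_p is the variable 'X_(p-1); positions are likewise
   counted from 0. *)
Record schubert (k n : nat) := Schubert {
  schubert_tuple :> k.-tuple 'I_n;
  _ : sorted ltn [seq val x | x <- schubert_tuple]
}.

HB.instance Definition _ (k n : nat) :=
  [isSub for @schubert_tuple k n].
HB.instance Definition _ (k n : nat) :=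
  [Finite of schubert k n by <:].

Section Symbols.
Variables k n : nat.
Implicit Types A B : schubert k n.

Definition sset A : {set 'I_n} := [set x in tval A].

Definition bruhat A B : bool := [forall r : 'I_k, (tnth A r <= tnth B r)%N].

(* The truncated subtraction is exact: a strictly increasing sequence has
   r <= tnth A r. *)
Definition sdim A : nat := (\sum_(r < k) (tnth A r - r))%N.

Definition exchanges A : {set schubert k n} :=
  [set B | [exists s : 'I_n, exists s' : 'I_n,
     [&& s \in sset A, s' \notin sset A, (s < s')%N &
         sset B == s' |: (sset A :\ s)]]].

Definition Ysum A : {mpoly int[n]} := \sum_(r < k) 'X_(tnth A r).

End Symbols.

Section Weights.
Variables (k n m : nat) (lam : 'I_m.+1 -> schubert k n).

Definition schubert_order : Prop :=
  bijective lam /\ forall i j, bruhat (lam i) (lam j) -> (i <= j)%N.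

Definition Rset (i : 'I_m.+1) : {set 'I_m.+1} :=
  [set j | lam i \in exchanges (lam j)].

(* Coordinate i of the wedge of the rows of a, in the basis (e_(lam i)), is
   the maximal minor of a on the columns lam i. *)
Definition in_Pl (C : fieldType) (z : 'I_m.+1 -> C) : Prop :=
  (exists a : 'M[C]_(k, n),
     forall i, z i = \det (\matrix_(r < k, c < k) a r (tnth (lam i) c)))
  /\ (exists i, z i != 0).

Definition plucker_weight (b : 'I_m.+1 -> nat) : Prop :=
  (forall i, (0 < b i)%N) /\
  forall (A B : {set 'I_n}) (l l' : 'I_n) (r s r' s' : 'I_m.+1),
    #|A|.+1 = k -> #|B| = k.+1 ->
    l \in B :\: A -> l' \in B :\: A ->
    sset (lam r) = l |: A -> sset (lam s) = B :\ l ->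
    sset (lam r') = l' |: A -> sset (lam s') = B :\ l' ->
    (b r + b s = b r' + b s')%N.

Definition plucker_perm (C : fieldType) (sigma : {perm 'I_m.+1}) : Prop :=
  exists t : 'I_m.+1 -> bool,
    forall z : 'I_m.+1 -> C,
      in_Pl z -> in_Pl (fun i => (-1) ^+ t i * z (sigma i)).

Definition div_chain (b : 'I_m.+1 -> nat) : Prop :=
  forall i j : 'I_m.+1, j = i.+1 :> nat -> (b j %| b i)%N.

Definition divisive (C : fieldType) (b : 'I_m.+1 -> nat) : Prop :=
  exists sigma : {perm 'I_m.+1},
    plucker_perm C sigma /\ div_chain (fun i => b (sigma i)).

Lemma div_chain_divisive (C : fieldType) (b : 'I_m.+1 -> nat) :
  div_chain b -> divisive C b.
Proof.
move=> hb; exists 1%g; split; last by move=> i j ij; rewrite !perm1; apply: hb.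
exists (fun=> false) => z [[a az] [i0 zi0]]; split.
  by exists a => i; rewrite expr0 mul1r perm1.
by exists i0; rewrite expr0 mul1r perm1.
Qed.

(* Y_(lam i) - (b_i / b_j) Y_(lam j).  It is only used for i in Rset j; then
   i < j, and the quotient is exact when div_chain b holds. *)
Definition edge_weight (b : 'I_m.+1 -> nat) (i j : 'I_m.+1) : {mpoly int[n]} :=
  Ysum (lam i) - (b i %/ b j)%N%:R * Ysum (lam j).

(* The image of the T^n-equivariant integral cohomology of Gr_b(k,n) under
   restriction to the fixed points: alpha j is the restriction at lam j. *)
Definition in_HT (b : 'I_m.+1 -> nat) (alpha : 'I_m.+1 -> {mpoly int[n]}) :
    Prop :=
  forall i j : 'I_m.+1, i \in Rset j ->
    exists q : {mpoly int[n]}, alpha j - alpha i = q * edge_weight b i j.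

Definition is_schubert_class (b : 'I_m.+1 -> nat) (i : 'I_m.+1)
    (alpha : 'I_m.+1 -> {mpoly int[n]}) : Prop :=
  [/\ in_HT b alpha,
      forall j, alpha j != 0 -> bruhat (lam i) (lam j),
      alpha i = \prod_(l in Rset i) edge_weight b l i &
      forall j, alpha j \is (sdim (lam i)).-homog].

(* The product in equivariant cohomology is pointwise at the fixed points. *)
Definition is_structure_constants
    (S : 'I_m.+1 -> 'I_m.+1 -> {mpoly int[n]})
    (C : 'I_m.+1 -> 'I_m.+1 -> 'I_m.+1 -> {mpoly int[n]}) : Prop :=
  forall i j p : 'I_m.+1, S i p * S j p = \sum_(l < m.+1) C i j l * S l p.

(* The n linear forms y_1 - y_2, ..., y_(n-1) - y_n, -Y_(lam 0); the last one
   sits at the index r for which r.+1 is out of range. *)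
Definition pos_form (r : 'I_n) : {mpoly int[n]} :=
  if insub r.+1 is Some r' then 'X_r - 'X_r' else - Ysum (lam ord0).

Definition pos_poly (p : {mpoly int[n]}) : Prop :=
  exists P : {mpoly int[n]},
    (forall mu : 'X_{1..n}, 0 <= P@_mu) /\
    p = comp_mpoly [tuple pos_form r | r < n] P.

End Weights.

(* Main.v *)
From HB Require Import structures.
Require Import Defs.
From mathcomp Require Import all_boot all_order all_fingroup all_algebra.
From mathcomp Require Import mpoly.
From mathcomp Require Import reals.
From mathcomp Require Import complex.
From mathcomp Require Import zify ring lra.

(** Let [w] be the weights with [b_lam = sum of w_r over r in lam] and put
    [y^p_r = y_r - (w_r / b_p) Y_p].  The Schubert class of lam restricts at p
    to the factorial Schur polynomial of lam in [x^p_j = y^p_(p_j)] with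
    parameters [y^p]: this family satisfies the divisibility conditions, and a
    class with the same support, degree and diagonal value is unique because a
    class vanishing below p is divisible at p by all the edges into p.

    Factorial Schur polynomials are written as sums over chains of columns
    (reverse semistandard tableaux).  Multiplying the product of falling powers
    [prod_j prod_(r < a_j) (y_r - x_j)] by such a sum, one column at a time,
    and alternating over the permutations of x, a term in which two exponents
    collide disappears since the remaining sum over tableaux is symmetric in
    the two variables concerned; every other term carries a product of factors
    [y^p_i - y^p_e] with [i <= e] (Molev-Sagan, in Graham-positive form).  Now
    [y^p_i - y^p_e = (y_i - y_e) - (w_i - w_e) Y_p / b_p] with [w_i >= w_e], and
    the weighted Chevalley formula [-(Y_p / b_p) S_l = (1 / b_l) (- Y_l S_l + the
    sum of the classes covering l)] shows that the structure constants are
    polynomials in the n forms with non-negative rational coefficients.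

    The forms span only a sublattice of index k.  Integrality of the
    coefficients comes from Gauss' lemma: the forms [Y_l - (b_l / b_p) Y_p] are
    primitive in that lattice, having value 1 at some integer point, and the
    restrictions, then the structure constants, are obtained recursively by
    dividing by products of them. *)

Set Implicit Arguments.
Unset Strict Implicit.
Unset Printing Implicit Defensive.

Import Order.TTheory GRing.Theory Num.Theory.

Local Open Scope ring_scope.

(** * Columns and tableaux *)

Section Columns.
Variable k : nat.
Implicit Types C D : {set 'I_k}.

Definition cnt C (v : nat) : nat := #|[set i in C | (i < v)%N]|.

(** Equivalently, [C'] has at most as many entries as [C] and its i-th smallest entry is at least
    that of [C]: the relation between consecutive columns of a tableau. *)
Definition col_le C' C : bool := [forall v : 'I_k.+1, (cnt C' v <= cnt C v)%N].

(** For [j] in [C] this is [j] minus its row, so [c + gap C j] is [j] plus the content of the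
    box. *)
Definition gap C (j : 'I_k) : nat := (j - cnt C j)%N.

Lemma col_leP C' C :
  reflect (forall v, (v <= k)%N -> (cnt C' v <= cnt C v)%N) (col_le C' C).
Proof.
apply: (iffP forallP) => h v; last by apply: h; rewrite -ltnS.
by move=> vk; apply: (h (Ordinal (n := k.+1) (m := v) vk)).
Qed.

Lemma cnt0 C : cnt C 0 = 0%N.
Proof. by apply: eq_card0 => i; rewrite inE ltn0 andbF. Qed.

Lemma cntS C (j : 'I_k) : cnt C j.+1 = (cnt C j + (j \in C))%N.
Proof.
rewrite /cnt (cardsD1 j) inE ltnSn andbT addnC; congr addn.
apply: eq_card => i; rewrite !inE ltnS leq_eqVlt -val_eqE /=.
by case: (i \in C); case: (ltngtP i j); rewrite ?andbF.
Qed.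

Lemma cnt_le C v : (v <= k)%N -> (cnt C v <= v)%N.
Proof.
elim: v => [|v IH] vk; first by rewrite cnt0.
rewrite (cntS C (Ordinal vk)) /=; have := IH (ltnW vk).
by case: (_ \in C) => /=; lia.
Qed.

Section Swap.
Variables j j1 : 'I_k.
Hypothesis jj1 : j1 = j.+1 :> nat.

Let neq_jj1 : j != j1.
Proof. by rewrite -val_eqE /= jj1; lia. Qed.

Definition swapset C : {set 'I_k} := [set i | tperm j j1 i \in C].

Lemma in_swapset C i : (i \in swapset C) = (tperm j j1 i \in C).
Proof. by rewrite inE. Qed.

Lemma in_swapsetL C : (j \in swapset C) = (j1 \in C).
Proof. by rewrite in_swapset tpermL. Qed.

Lemma in_swapsetR C : (j1 \in swapset C) = (j \in C).
Proof. by rewrite in_swapset tpermR. Qed.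

Lemma swapsetK : involutive swapset.
Proof. by move=> C; apply/setP=> i; rewrite !in_swapset tpermK. Qed.

Lemma card_swapset C : #|swapset C| = #|C|.
Proof.
have -> : swapset C = (tperm j j1) @^-1: C by apply/setP => i; rewrite !inE.
by rewrite card_preimset //; apply: perm_inj.
Qed.

Lemma cnt_swapset_le C v : (v <= j)%N -> cnt (swapset C) v = cnt C v.
Proof.
move=> vj; apply: eq_card => i; rewrite !inE.
have h : (j1 < v)%N = false by rewrite jj1; lia.
have h' : (j < v)%N = false by rewrite ltnNge vj.
by case: tpermP => [->|->|] //; rewrite !(h, h') !andbF.
Qed.

Lemma cnt_swapset C v : v != j1 :> nat -> (v <= k)%N -> cnt (swapset C) v = cnt C v.
Proof.
move=> vj1 vk; have [/cnt_swapset_le-> //|jv] := leqP v j.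
have [d dE] : exists d, v = (j1.+1 + d)%N by exists (v - j1.+1)%N; lia.
elim: d v dE {vj1 jv} vk => [|d IH] v -> vk.
  rewrite addn0 !cntS !jj1 !cntS cnt_swapset_le // in_swapsetL in_swapsetR.
  by rewrite -!addnA [((j1 \in C) + _)%N]addnC.
have dk : (j1.+1 + d < k)%N by lia.
rewrite addnS (cntS _ (Ordinal dk)) (cntS C (Ordinal dk)) /= IH //; last by lia.
by rewrite in_swapset tpermD // -val_eqE /=; lia.
Qed.

Lemma cnt_swapset_mid C :
  cnt (swapset C) j1 = (cnt C j + (j1 \in C))%N.
Proof. by rewrite jj1 cntS cnt_swapset_le // in_swapsetL. Qed.

Lemma gap_swapset C i : i != j -> i != j1 -> gap (swapset C) i = gap C i.
Proof. by move=> ij ij1; rewrite /gap cnt_swapset // ltnW. Qed.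

Lemma gap_swapset_mid C : gap (swapset C) j1 = ((gap C j).+1 - (j1 \in C))%N.
Proof.
rewrite /gap cnt_swapset_mid jj1; have := cnt_le C (ltnW (ltn_ord j)).
by case: (_ \in C) => /=; lia.
Qed.

Definition single C : bool := (j \in C) && (j1 \notin C).

(** The two relations differ only in the count at [j1]. That count is bounded because of the count
    at [j] when [j] is in [C], and because of the count at [j1.+1] when neither index is. *)
Lemma col_le_swap_id C C' :
  single C' -> (single C || ((j \in C) == (j1 \in C))) ->
  col_le (swapset C') C = col_le C' C.
Proof.
move=> /andP[jC' j1C'] hC; apply/col_leP/col_leP => h v vk.
  have [vE|nv] := eqVneq v (j1 : nat); last by rewrite -(cnt_swapset C') ?h.
  have hj := h _ (ltnW (ltn_ord j)); rewrite cnt_swapset_le // in hj.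
  have := h _ (ltn_ord j1); rewrite vE !cntS cnt_swapset_mid in_swapsetR.
  rewrite jC' (negbTE j1C') jj1 !cntS jC' /=.
  by case/orP: hC => [/andP[-> /negbTE->]|/eqP->] /=; try case: (j1 \in C) => /=; lia.
have [vE|nv] := eqVneq v (j1 : nat); last by rewrite cnt_swapset ?h.
rewrite vE cnt_swapset_mid (negbTE j1C') addn0 jj1 cntS.
by have := h _ (ltnW (ltn_ord j)); lia.
Qed.

Lemma col_le_swapR C C' : single C -> col_le C' (swapset C) -> col_le C' C.
Proof.
move=> /andP[jC j1C] /col_leP h; apply/col_leP => v vk.
have [vE|nv] := eqVneq v (j1 : nat); last by rewrite -(cnt_swapset C) ?h.
apply: leq_trans (h _ vk) _; rewrite vE cnt_swapset_mid jj1 cntS.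
by rewrite jC (negbTE j1C); lia.
Qed.

(** The relation can only fail at [j1], so [C'] has more entries below [j1] than [C] has below [j].
    The counts at [j] must then agree, which fixes the gap and forces [j] into [C']; the count at
    [j1.+1] excludes [j1]. *)
Lemma col_le_swap_lost C C' :
  single C -> col_le C' C -> ~~ col_le C' (swapset C) ->
  single C' /\ gap C' j = gap C j.
Proof.
move=> /andP[jC j1C] /col_leP h /col_leP h'.
have lost : (cnt C j < cnt C' j1)%N.
  rewrite ltnNge; apply/negP => le; apply: h' => v vk.
  have [vE|nv] := eqVneq v (j1 : nat); last by rewrite (cnt_swapset C) ?h.
  by rewrite vE cnt_swapset_mid (negbTE j1C) addn0.
have := h _ (ltnW (ltn_ord j)); have := h _ (ltn_ord j1).
move: lost; rewrite /single /gap !cntS !jj1 !cntS jC (negbTE j1C).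
by case: (j \in C'); case: (j1 \in C') => /=; split=> //; lia.
Qed.

End Swap.
End Columns.

(** * Tableau sums and their symmetry in adjacent variables *)

Section Tableaux.
Variables (A : comNzRingType) (k : nat) (y : nat -> A).
Implicit Types (C D : {set 'I_k}) (x : {ffun 'I_k -> A}) (L : seq nat).

Definition col_weight c C x : A := \prod_(j in C) (y (c + gap C j)%N - x j).

(* With L the column lengths of a partition and C = setT, this is its factorial
   Schur polynomial: C' runs over the possible columns of index c of a reverse
   semistandard tableau whose previous column is C. *)
Fixpoint tab L c C x : A :=
  if L is l :: L' then
    \sum_(C' | col_le C' C && (#|C'| == l)) col_weight c C' x * tab L' c.+1 C' x
  else 1.

Definition permx (s : 'S_k) x : {ffun 'I_k -> A} := [ffun i => x (s i)].

Section Adjacent.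
Variables j j1 : 'I_k.
Hypothesis jj1 : j1 = j.+1 :> nat.
Let s := tperm j j1.
Let tau := swapset j j1.

Let neq_jj1 : j != j1.
Proof. by rewrite -val_eqE /= jj1; lia. Qed.

Let rest c C x : A :=
  \prod_(i in C :\: [set j; j1]) (y (c + gap C i)%N - x i).

Let rest_perm c C x : rest c C (permx s x) = rest c C x.
Proof.
apply: eq_bigr => i; rewrite !inE negb_or => /andP[/andP[ij ij1] _].
by rewrite ffunE tpermD // eq_sym.
Qed.

Let rest_tau c C x : rest c (tau C) x = rest c C x.
Proof.
apply: eq_big => i.
  rewrite !inE; case: (eqVneq i j) => //= ij; case: (eqVneq i j1) => //= ij1.
  by rewrite tpermD // eq_sym.
rewrite !inE negb_or => /andP[/andP[ij ij1] _].
by rewrite gap_swapset.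
Qed.

Let col_weight_rest c C x :
  col_weight c C x = (if j \in C then y (c + gap C j)%N - x j else 1)
    * (if j1 \in C then y (c + gap C j1)%N - x j1 else 1) * rest c C x.
Proof.
rewrite /col_weight (bigID (mem [set j; j1])) /=; congr (_ * _); last first.
  by apply: eq_bigl => i; rewrite !inE andbC.
rewrite (bigID (pred1 j)) /=; congr (_ * _).
  rewrite (eq_bigl (fun i => (i == j) && (j \in C))); last first.
    by move=> i; rewrite !inE /=; case: (eqVneq i j) => [->|]; rewrite ?andbF ?andbT.
  case: (j \in C); last by rewrite big_pred0 // => i; rewrite andbF.
  by rewrite (eq_bigl (pred1 j)) ?big_pred1_eq // => i; rewrite andbT.
rewrite (eq_bigl (fun i => (i == j1) && (j1 \in C))); last first.
  move=> i; rewrite !inE /=; case: (eqVneq i j1) => [->|].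
    by rewrite orbT andbT eq_sym neq_jj1 andbT.
  by case: (eqVneq i j); rewrite ?andbF.
case: (j1 \in C); last by rewrite big_pred0 // => i; rewrite andbF.
by rewrite (eq_bigl (pred1 j1)) ?big_pred1_eq // => i; rewrite andbT.
Qed.

(* Sums over the columns below C are grouped along the involution exchanging
   j and j1; the second clause is what makes a group of two symmetric. *)
Lemma tab_adjacent L c C :
  ((single j j1 C || ((j \in C) == (j1 \in C))) ->
     forall x, tab L c C (permx s x) = tab L c C x) /\
  (single j j1 C -> exists2 D : {ffun 'I_k -> A} -> A,
     (forall x, D (permx s x) = D x) &
     forall x, tab L c C x - tab L c (tau C) x
       = (y (c + gap C j)%N - x j) * D x).
Proof.
elim: L c C => [|l L IH] c C.
  by split=> // _; exists (fun=> 0) => // x; rewrite subrr mulr0.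
have sym1 C' x : (j \in C') == (j1 \in C') ->
    col_weight c C' (permx s x) * tab L c.+1 C' (permx s x)
    = col_weight c C' x * tab L c.+1 C' x.
  move=> e; rewrite (proj1 (IH _ _)) ?e ?orbT //; congr (_ * _).
  rewrite !col_weight_rest rest_perm !ffunE tpermL tpermR.
  move/eqP: e; case: ifP => jC <- //; congr (_ * _).
  have -> : gap C' j1 = gap C' j by rewrite /gap jj1 cntS jC; lia.
  by rewrite mulrC.
have sym2 C' x : single j j1 C' ->
    let h x C' := col_weight c C' x * tab L c.+1 C' x in
    h (permx s x) C' + h (permx s x) (tau C') = h x C' + h x (tau C').
  move=> sC' h; have [jC' j1C'] := andP sC'.
  have [hs /(_ sC')[D Ds DE]] := IH c.+1 C'.
  have hs' z := hs _ z; rewrite sC' /= in hs'.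
  have tabE z : tab L c.+1 (tau C') z =
      tab L c.+1 C' z - (y (c.+1 + gap C' j)%N - z j) * D z.
    by rewrite -DE; ring.
  have gE : gap (tau C') j1 = (gap C' j).+1.
    by rewrite gap_swapset_mid // (negbTE j1C') subn0.
  (* With [g = c + gap C' j] and [T] the symmetric sum at [C'], the pair adds up, apart from [rest],
     to [(y g - x j + y g.+1 - x j1) * T - (y g.+1 - x j1) * (y g.+1 - x j) * D], which is symmetric
     in the two variables. *)
  rewrite /h !tabE !Ds !hs' // !col_weight_rest !rest_perm !rest_tau !ffunE.
  rewrite /tau in_swapsetL in_swapsetR jC' (negbTE j1C') /= gE addSn addnS.
  by rewrite /s tpermL tpermR; ring.
split=> [hC x|sC].
  rewrite /= (bigID (fun C' => (j \in C') == (j1 \in C'))) /=.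
  rewrite [RHS](bigID (fun C' => (j \in C') == (j1 \in C'))) /=; congr (_ + _).
    by apply: eq_bigr => C' /andP[_ e]; apply: sym1.
  rewrite (bigID (single j j1)) /= [RHS](bigID (single j j1)) /=.
  (* The columns with [j1] but not [j] are the [tau]-images of those with [j] but not [j1], and a
     column and its image are admissible together. *)
  have E (h : {set 'I_k} -> A) :
      \sum_(C' | col_le C' C && (#|C'| == l) && ((j \in C') != (j1 \in C'))
          && ~~ single j j1 C') h C' =
      \sum_(C' | col_le C' C && (#|C'| == l) && ((j \in C') != (j1 \in C'))
          && single j j1 C') h (tau C').
    rewrite (reindex_inj (inv_inj (swapsetK j j1))) /=.
    apply: eq_bigl => C'; rewrite card_swapset /single in_swapsetL in_swapsetR.
    case jC': (j \in C'); case j1C': (j1 \in C'); rewrite ?andbF //= !andbT.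
    by rewrite col_le_swap_id // /single jC' j1C'.
  rewrite !E -!big_split /=; apply: eq_bigr => C' /andP[_ sC'].
  exact: sym2.
(* Only columns admissible after [C] but not after [tau C] survive in the difference. All have the
   gap of [C] at [j], so the factor at [j] comes out of the sum. *)
exists (fun x => \sum_(C' | [&& col_le C' C, ~~ col_le C' (tau C) & #|C'| == l])
                  rest c C' x * tab L c.+1 C' x) => x.
  apply: eq_bigr => C' /and3P[h1 h2 _]; rewrite rest_perm.
  have [sC' _] := col_le_swap_lost jj1 sC h1 h2.
  by rewrite (proj1 (IH _ _)) ?sC'.
rewrite /= (bigID (fun C' => col_le C' (tau C))) /= addrAC.
rewrite (eq_bigl (fun C' => col_le C' (tau C) && (#|C'| == l))); last first.
  move=> C'; case h: (col_le C' (tau C)); rewrite ?andbF //= andbT.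
  by rewrite (col_le_swapR jj1 sC h).
rewrite subrr add0r mulr_sumr; apply: eq_big => C'.
  by rewrite -andbA [(#|C'| == l) && _]andbC.
move=> /andP[/andP[h1 _] h2]; have [sC' gE] := col_le_swap_lost jj1 sC h1 h2.
rewrite col_weight_rest; case/andP: sC' => -> /negbTE ->.
by rewrite gE mulr1 mulrA.
Qed.

Lemma tab_sym L c C x : j \in C \/ j1 \notin C ->
  tab L c C (permx s x) = tab L c C x.
Proof.
move=> h; apply: (proj1 (tab_adjacent L c C)); rewrite /single.
by case: h => [->|/negbTE->]; case: (_ \in _).
Qed.

End Adjacent.
End Tableaux.

(** * Alternants and their products with tableau sums *)

Section Alternants.
Variables (A : comNzRingType) (k : nat) (y : nat -> A).
Implicit Types (C D B : {set 'I_k}) (x : {ffun 'I_k -> A}) (L : seq nat).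
Implicit Types (a : {ffun 'I_k -> nat}) (s t : 'S_k).

Lemma permxM s t x : permx s (permx t x) = permx (s * t)%g x.
Proof. by apply/ffunP => i; rewrite !ffunE permM. Qed.

Lemma permx1 x : permx 1%g x = x.
Proof. by apply/ffunP => i; rewrite !ffunE perm1. Qed.

(** Adjacent transpositions generate the symmetric group: a longer transposition is the conjugate of
    a shorter one by an adjacent one. *)
Lemma adjacent_sym (G : {ffun 'I_k -> A} -> A) :
  (forall j j1 : 'I_k, j1 = j.+1 :> nat ->
     forall x, G (permx (tperm j j1) x) = G x) ->
  forall s x, G (permx s x) = G x.
Proof.
move=> hG.
have tp d (i j : 'I_k) x : (j = i + d.+1 :> nat)%N -> G (permx (tperm i j) x) = G x.
  elim: d j x => [|d IH] j x jE; first by apply: hG; rewrite jE addn1.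
  have j'k : (i + d.+1 < k)%N by rewrite (leq_trans _ (ltn_ord j)) // jE; lia.
  pose j' := Ordinal j'k.
  have -> : tperm i j = (tperm j' j * (tperm i j' * tperm j' j))%g.
    have nij' : j' != i by rewrite -val_eqE /=; lia.
    have nij : j != i by rewrite -val_eqE /=; lia.
    by rewrite -{1}(tpermV j' j) -conjgE tpermJ tpermL tpermD.
  by rewrite -!permxM hG ?IH ?hG //= ?jE; lia.
have tpg (i j : 'I_k) x : G (permx (tperm i j) x) = G x.
  case: (ltngtP i j) => ij.
  - by apply: (tp (j - i.+1)%N); lia.
  - by rewrite tpermC; apply: (tp (i - j.+1)%N); lia.
  - by have -> : i = j by [apply: val_inj]; rewrite tperm1 permx1.
move=> s; have [ts -> _] := prod_tpermP s.
elim: ts => [|p ts IH] x; first by rewrite big_nil permx1.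
by rewrite big_cons -permxM tpg IH.
Qed.

Lemma tab_setT_sym L c s x : tab y L c setT (permx s x) = tab y L c setT x.
Proof.
by apply: adjacent_sym => j j1 jj1 z; apply: tab_sym => //; left; rewrite inE.
Qed.

Definition alt (phi : {ffun 'I_k -> A} -> A) x : A :=
  \sum_(s : 'S_k) (-1) ^+ s * phi (permx s x).

Lemma eq_alt phi psi x : (forall x, phi x = psi x) -> alt phi x = alt psi x.
Proof. by move=> e; apply: eq_bigr => s _; rewrite e. Qed.

Lemma alt_sum (I : finType) (P : pred I) (F : I -> {ffun 'I_k -> A} -> A) x :
  alt (fun x => \sum_(i | P i) F i x) x = \sum_(i | P i) alt (F i) x.
Proof. by rewrite exchange_big; apply: eq_bigr => s _; rewrite mulr_sumr. Qed.

Lemma alt_mull_sym (G phi : {ffun 'I_k -> A} -> A) x :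
  (forall s x, G (permx s x) = G x) ->
  alt (fun x => G x * phi x) x = G x * alt phi x.
Proof.
by move=> h; rewrite mulr_sumr; apply: eq_bigr => s _; rewrite h mulrCA.
Qed.

Lemma alt_eq0 phi (i j : 'I_k) x : i != j ->
  (forall x, phi (permx (tperm i j) x) = phi x) -> alt phi x = 0.
Proof.
move=> ij h; rewrite /alt (bigID (fun s : 'S_k => odd_perm s)) /=.
rewrite [X in X + _](reindex_inj (mulgI (tperm i j))) /=.
rewrite [X in X + _](eq_bigl (fun s : 'S_k => ~~ s)); last first.
  by move=> s; rewrite odd_permM odd_tperm ij; case: (odd_perm s).
rewrite -big_split big1 //= => s sE; rewrite odd_permM odd_tperm ij /=.
by rewrite -permxM h -mulrDl (negbTE sE) expr0 expr1 addNr mul0r.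
Qed.

Definition fpow (e : nat) (u : A) : A := \prod_(r < e) (y r - u).

Lemma fpowS e u : fpow e.+1 u = fpow e u * (y e - u).
Proof. by rewrite /fpow big_ord_recr. Qed.

Lemma fpow_eq0 e r : (r < e)%N -> fpow e (y r) = 0.
Proof. by move=> re; rewrite /fpow (bigD1 (Ordinal re)) //= subrr mul0r. Qed.

Definition fmon a x : A := \prod_i fpow (a i) (x i).

(** The determinant of the falling powers of exponents [a i] at the points [x j]: the numerator of
    the bialternant formula for factorial Schur polynomials. *)
Definition falt a x : A := alt (fmon a) x.

Definition strict a : bool :=
  [forall i : 'I_k, forall j : 'I_k, (j == i.+1 :> nat) ==> (a i < a j)%N].

Lemma strictP a :
  reflect (forall i j : 'I_k, j = i.+1 :> nat -> (a i < a j)%N) (strict a).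
Proof.
apply: (iffP forallP) => h i.
  by move=> j ij; have /forallP/(_ j)/implyP := h i; apply; rewrite ij.
by apply/forallP => j; apply/implyP => /eqP; apply: h.
Qed.

Lemma strict_lt a (i j : 'I_k) : strict a -> (i < j)%N -> (a i + (j - i) <= a j)%N.
Proof.
move=> /strictP h ij; have [d dE] : exists d, (j = i + d.+1 :> nat)%N.
  by exists (j - i.+1)%N; lia.
elim: d j dE {ij} => [|d IH] j dE; first by have := h i j; lia.
have j'k : (i + d.+1 < k)%N by rewrite (leq_trans _ (ltn_ord j)) // dE; lia.
have := IH (Ordinal j'k) erefl; have := h (Ordinal j'k) j; rewrite /=; lia.
Qed.

Definition raise a B : {ffun 'I_k -> nat} := [ffun i => (a i + (i \in B))%N].

Definition step_weight c C B a : A :=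
  \prod_(j in C :\: B) (y (c + gap C j)%N - y (a j)).

(** Split each factor as [(y (c + gap C j) - y (a j)) + (y (a j) - x j)]. The second summand raises
    the exponent at [j] by one; [B] collects the indices where it is chosen. *)
Lemma col_weight_fmon c C a x :
  col_weight y c C x * fmon a x =
  \sum_(B : {set 'I_k} | B \subset C) step_weight c C B a * fmon (raise a B) x.
Proof.
rewrite /col_weight /fmon [X in X * _]big_mkcond -big_split /=.
pose F i := if i \in C then fpow (a i).+1 (x i) else 0.
pose G i := if i \in C then (y (c + gap C i)%N - y (a i)) * fpow (a i) (x i)
            else fpow (a i) (x i).
rewrite (eq_bigr (fun i => F i + G i)); last first.
  by move=> i _; rewrite /F /G; case: ifP => _; rewrite ?fpowS; ring.
rewrite bigA_distr [LHS](bigID (fun B : {set 'I_k} => B \subset C)) /=.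
rewrite [X in _ + X]big1 ?addr0 => [|B /subsetPn[i iB iC]]; last first.
  by rewrite (bigD1 i) //= iB /F (negbTE iC) mul0r.
apply: eq_bigr => B BC; rewrite /step_weight [X in X * _]big_mkcond -big_split /=.
apply: eq_bigr => i _; rewrite ffunE inE /F /G.
case iB: (i \in B) => /=; first by rewrite (subsetP BC _ iB) addn1 mul1r.
by rewrite addn0; case: ifP; rewrite ?mul1r.
Qed.

(** Exponents grow by at most one, so strictness can only be lost by an equality between neighbours
    of which just the lower one is raised. *)
Lemma raise_not_strict a B : strict a -> ~~ strict (raise a B) ->
  exists i j : 'I_k, [/\ j = i.+1 :> nat, i \in B & raise a B i = raise a B j].
Proof.
move=> /strictP sa; rewrite negb_forall => /existsP[] i; rewrite negb_forall.
case/existsP => j; rewrite negb_imply => /andP[/eqP ij]; rewrite -leqNgt !ffunE.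
have := sa _ _ ij => lt le; exists i, j; rewrite !ffunE ij; split=> //.
  by case: (i \in B) le => //=; lia.
by move: le; case: (i \in B); case: (j \in B) => /=; lia.
Qed.

(* When raising along B breaks strictness, i lies in the new column C' for the
   offending pair (i, i+1), so the remaining sum is symmetric there and its
   product with the (now symmetric) monomial is killed by alternation. *)
Lemma alt_tab_cons l L c C a x : strict a ->
  alt (fun x => tab y (l :: L) c C x * fmon a x) x =
  \sum_(C' : {set 'I_k} | col_le C' C && (#|C'| == l))
   \sum_(B : {set 'I_k} | (B \subset C') && strict (raise a B))
     step_weight c C' B a *
     alt (fun x => tab y L c.+1 C' x * fmon (raise a B) x) x.
Proof.
move=> sa; rewrite (@eq_alt _ (fun x => \sum_(C' | col_le C' C && (#|C'| == l))
    \sum_(B : {set 'I_k} | B \subset C') step_weight c C' B a *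
      (tab y L c.+1 C' x * fmon (raise a B) x))); last first.
  move=> z /=; rewrite mulr_suml; apply: eq_bigr => C' _.
  rewrite mulrAC col_weight_fmon mulr_suml; apply: eq_bigr => B _; ring.
rewrite alt_sum; apply: eq_bigr => C' _; rewrite alt_sum.
rewrite (bigID (fun B => strict (raise a B))) /= [X in _ + X]big1 ?addr0.
  by apply: eq_bigr => B _; rewrite alt_mull_sym.
move=> B /andP[BC nst]; rewrite alt_mull_sym //.
have [i [j [ij iB eij]]] := raise_not_strict sa nst.
rewrite (@alt_eq0 _ i j) ?mulr0 // => [|z]; first by rewrite -val_eqE /= ij; lia.
rewrite tab_sym //; last by left; apply: (subsetP BC).
congr (_ * _); rewrite /fmon (reindex_inj (@perm_inj _ (tperm i j))) /=.
apply: eq_bigr => u _; rewrite [permx _ _ _]ffunE tpermK; congr fpow.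
by case: tpermP => [->|->|].
Qed.

(** The Pieri rule for one box: the multiplier is symmetric, so it may be moved inside the
    alternation, where its summand [y (a j) - x j] raises the j-th falling power. *)
Lemma fpow_diff_sum a x :
  (\sum_j y (a j) - \sum_j x j) * falt a x =
  \sum_j falt (raise a [set j]) x.
Proof.
rewrite -(@alt_mull_sym (fun x => \sum_j y (a j) - \sum_j x j)) => [|s z]; last first.
  congr (_ - _); rewrite [RHS](reindex_inj (@perm_inj _ s)) /=.
  by apply: eq_bigr => i _; rewrite ffunE.
rewrite -alt_sum; apply: eq_alt => z; rewrite -sumrB mulr_suml.
apply: eq_bigr => j _; rewrite /fmon (bigD1 j) //= [RHS](bigD1 j) //= !ffunE.
rewrite set11 addn1 fpowS mulrA [_ * fpow _ _]mulrC; congr (_ * _).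
by apply: eq_bigr => i ij; rewrite ffunE inE (negbTE ij) addn0.
Qed.

Lemma falt_eq0 a x (i j : 'I_k) : i != j -> a i = a j -> falt a x = 0.
Proof.
move=> ij e; rewrite /falt (alt_eq0 (i := i) (j := j)) // => z.
rewrite /fmon (reindex_inj (@perm_inj _ (tperm i j))) /=.
apply: eq_bigr => u _; rewrite [permx _ _ _]ffunE tpermK; congr fpow.
by case: tpermP => [->|->|].
Qed.

End Alternants.

(** * Smallest entries of columns *)

Section ColumnMinimum.
Variable k : nat.
Implicit Types C D B : {set 'I_k}.

Lemma cnt_gt0P C v : reflect (exists2 j, j \in C & (j < v)%N) (0 < cnt C v)%N.
Proof.
apply: (iffP card_gt0P) => [[j]|[j jC jv]]; first by rewrite inE => /andP[]; exists j.
by exists j; rewrite inE jC.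
Qed.

Lemma col_le_min C' C (j : 'I_k) : col_le C' C -> j \in C' ->
  exists2 i, i \in C & (i <= j)%N.
Proof.
move=> /col_leP h jC'; have /cnt_gt0P[i iC ij] : (0 < cnt C j.+1)%N.
  by apply: leq_trans (h _ (ltn_ord j)); apply/cnt_gt0P; exists j.
by exists i.
Qed.

Lemma sub_col_le C' C : C' \subset C -> col_le C' C.
Proof.
move=> /subsetP h; apply/col_leP => v _; apply/subset_leq_card/subsetP => i.
by rewrite !inE => /andP[/h-> ->].
Qed.

Lemma min_gap C (j : 'I_k) : j \in C ->
  exists j0 : 'I_k, [/\ j0 \in C, (j0 <= j)%N, gap C j0 = j0
                  & forall i, i \in C -> (j0 <= i)%N].
Proof.
move=> jC; case: (@arg_minnP _ j (mem C) (fun i : 'I_k => i : nat) jC) => j0 j0C hmin.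
exists j0; split=> //; first exact: hmin.
rewrite /gap; suff -> : cnt C j0 = 0%N by rewrite subn0.
apply/eqP; rewrite -leqn0 leqNgt; apply/negP => /cnt_gt0P[i iC].
by rewrite ltnNge hmin.
Qed.

End ColumnMinimum.

(** * Factorial Schur polynomials as quotients of alternants *)

Section ShapeTableaux.
Variables (A : comNzRingType) (k : nat) (y : nat -> A).
Implicit Types (C D B : {set 'I_k}) (x : {ffun 'I_k -> A}) (L : seq nat).
Implicit Types (a t : {ffun 'I_k -> nat}).

Lemma strict_ge a (j : 'I_k) : strict a -> (j <= a j)%N.
Proof.
case: j => [[|j] jk] //= sa; have k0 : (0 < k)%N by apply: leq_ltn_trans jk.
by have /= := strict_lt (i := Ordinal k0) (j := Ordinal jk) sa isT; lia.
Qed.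

(** Row [j] of the diagram of [a] has [a j - j] boxes; these are the rows that meet column [c]. *)
Definition shape_col a (c : nat) : {set 'I_k} := [set j : 'I_k | (c + j < a j)%N].

Definition col_sizes a (m : nat) : seq nat :=
  [seq #|shape_col a c| | c <- iota 0 m].

Definition base_state : {ffun 'I_k -> nat} := [ffun i : 'I_k => i : nat].

(** The exponents of the diagram cut down to its first [c] columns. *)
Let trunc a (c : nat) : {ffun 'I_k -> nat} :=
  [ffun j : 'I_k => (j + minn (a j - j) c)%N].

Lemma strict_mono_sub a (i j : 'I_k) : strict a -> (i <= j)%N ->
  (a i - i <= a j - j)%N.
Proof.
move=> sa; rewrite leq_eqVlt => /orP[/eqP/val_inj->|ij] //.
by have := strict_lt sa ij; lia.
Qed.

Let trunc_strict a c : strict a -> strict (trunc a c).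
Proof.
move=> sa; apply/strictP => i j ij; rewrite !ffunE ij.
by have := strict_mono_sub (i := i) (j := j) sa; rewrite ij; lia.
Qed.

Let raise_trunc a c : raise (trunc a c) (shape_col a c) = trunc a c.+1.
Proof.
apply/ffunP => j; rewrite !ffunE inE.
by case: (ltnP (c + j)%N (a j)) => h /=; lia.
Qed.

(** The column of the shape before column [c]; for [c = 0] and strict [a] it is [setT]. *)
Let prev a c : {set 'I_k} := [set j : 'I_k | (c + j <= a j)%N].

(* The first box of a contributing column must be raised, for otherwise its
   factor is y_(c+j) - y_(c+j) = 0; strictness then forces every higher index
   to be raised too. *)
Let trunc_unique a c C' B : strict a -> col_le C' (prev a c) ->
  #|C'| = #|shape_col a c| -> B \subset C' -> strict (raise (trunc a c) B) ->
  step_weight y c C' B (trunc a c) != 0 ->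
  C' = shape_col a c /\ B = C'.
Proof.
move=> sa le card BC sr nz.
have [C0|[j jC']] := set_0Vmem C'.
  move: BC card; rewrite C0 subset0 cards0 => /eqP-> /esym/eqP.
  by rewrite cards_eq0 => /eqP->.
have [j0 [j0C' _ gE hmin]] := min_gap jC'.
have [i /[!inE] hi ij0] := col_le_min le j0C'.
have aj0 : (c + j0 <= a j0)%N.
  by have := strict_mono_sub sa ij0; have := strict_ge j0 sa; lia.
have j0B : j0 \in B.
  apply: contraNT nz => j0B; apply/eqP.
  rewrite /step_weight (bigD1 j0) ?inE ?j0B //= gE ffunE (minn_idPr _); last by lia.
  by rewrite [(j0 + c)%N]addnC subrr mul0r.
have upB (v : 'I_k) : (j0 <= v)%N -> v \in B.
  rewrite leq_eqVlt => /orP[/eqP/val_inj<-|lt] //.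
  have := strict_lt sr lt; rewrite !ffunE j0B.
  by case: (v \in B) => //=; lia.
have CE (v : 'I_k) : (v \in C') = (j0 <= v)%N.
  by apply/idP/idP => [/hmin|/upB/(subsetP BC)].
have BE : B = C'.
  by apply/eqP; rewrite eqEsubset BC; apply/subsetP => v; rewrite CE => /upB.
split=> //.
have [j0D|j0D] := boolP (j0 \in shape_col a c).
  apply/eqP; rewrite eqEcard card leqnn andbT; apply/subsetP => v.
  rewrite CE => /(strict_mono_sub sa); move: j0D; rewrite !inE.
  by have := strict_ge v sa; lia.
apply/esym/eqP; rewrite eqEcard card leqnn andbT; apply/subsetP => v; rewrite CE.
move: j0D; rewrite !inE -leqNgt leqNgt => h1 h2; rewrite leqNgt; apply/negP => vj.
by have := strict_mono_sub sa (ltnW vj); have := strict_ge v sa; lia.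
Qed.

(** Induction on the number of remaining columns: in each one-column expansion only the term raising
    the exponents along the next column of the shape survives. *)
Let alt_tab_trunc a m c x : strict a ->
  alt (fun x => tab y [seq #|shape_col a c| | c <- iota c m] c (prev a c) x
         * fmon y (trunc a c) x) x = falt y (trunc a (c + m)) x.
Proof.
move=> sa; elim: m c => [|m IH] c.
  by rewrite addn0; apply: eq_alt => z; rewrite /= mul1r.
rewrite [map _ _]/= alt_tab_cons; last exact: trunc_strict.
have pD : shape_col a c = prev a c.+1 by apply/setP => i; rewrite !inE.
rewrite (bigD1 (shape_col a c)) /=; last first.
  by rewrite eqxx andbT; apply: sub_col_le; apply/subsetP => i; rewrite !inE => /ltnW.
rewrite (bigD1 (shape_col a c)) /=; last by rewrite subxx raise_trunc trunc_strict.
rewrite {1}/step_weight setDv big_set0 mul1r raise_trunc {2}pD IH addnS addSn.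
rewrite !big1 ?addr0 // => [C' /andP[/andP[le /eqP card] ne]|B /andP[/andP[BC sr] ne]].
  apply: big1 => B /andP[BC sr]; apply/eqP; apply: contraNT ne => nz'.
  have nz : step_weight y c C' B (trunc a c) != 0.
    by apply: contraNneq nz' => ->; rewrite mul0r.
  by have [-> _] := trunc_unique sa le card BC sr nz.
apply/eqP; apply: contraNT ne => nz'.
have nz : step_weight y c (shape_col a c) B (trunc a c) != 0.
  by apply: contraNneq nz' => ->; rewrite mul0r.
have [|_ ->//] := trunc_unique sa _ erefl BC sr nz.
by apply: sub_col_le; apply/subsetP => i; rewrite !inE => /ltnW.
Qed.

Lemma tab_falt a L c x :
  tab y L c setT x * falt y a x = alt (fun x => tab y L c setT x * fmon y a x) x.
Proof. by rewrite alt_mull_sym // => s z; apply: tab_setT_sym. Qed.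

(** The bialternant formula. Starting from the exponents [0, ..., k-1], the columns of the shape
    rebuild [a]. *)
Lemma tab_shape_base a m x : strict a -> (forall j, a j <= m)%N ->
  tab y (col_sizes a m) 0 setT x * falt y base_state x = falt y a x.
Proof.
move=> sa am; rewrite tab_falt.
have := @alt_tab_trunc a m 0 x sa.
have -> : prev a 0 = setT by apply/setP => j; rewrite !inE strict_ge.
have -> : trunc a 0 = base_state by apply/ffunP => j; rewrite !ffunE minn0 addn0.
rewrite add0n => ->; congr falt; apply/ffunP => j; rewrite ffunE.
by have /minn_idPl -> := leq_trans (leq_subr j _) (am j); rewrite subnKC ?strict_ge.
Qed.

End ShapeTableaux.

(** * Evaluation of alternants *)

Section Values.
Variables (A : comNzRingType) (k : nat) (y : nat -> A).
Implicit Types (a t : {ffun 'I_k -> nat}) (x : {ffun 'I_k -> A}).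

(** Pigeonhole: if [t i < a i], then [s] would map the indices from [i] on injectively into those
    after [i]. *)
Lemma strict_perm_le a t (s : 'S_k) : strict a -> strict t ->
  (forall i, a i <= t (s i))%N -> forall i, (a i <= t i)%N.
Proof.
move=> sa st h i; rewrite leqNgt; apply/negP => lt.
have sub : s @: [set j : 'I_k | (i <= j)%N] \subset [set j : 'I_k | (i < j)%N].
  apply/subsetP => u /imsetP[j]; rewrite inE => ij ->; rewrite inE ltnNge.
  apply/negP => sij; have := h j.
  have : (a i <= a j)%N.
    by move: ij; rewrite leq_eqVlt => /orP[/eqP/val_inj->//|/(strict_lt sa)]; lia.
  have : (t (s j) <= t i)%N.
    by move: sij; rewrite leq_eqVlt => /orP[/eqP/val_inj->//|/(strict_lt st)]; lia.
  by lia.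
have := subset_leq_card sub; rewrite card_imset; last exact: perm_inj.
rewrite leqNgt => /negP; apply; apply: proper_card; apply/properP; split.
  by apply/subsetP => j; rewrite !inE => /ltnW.
by exists i; rewrite !inE ?leqnn ?ltnn.
Qed.

Lemma perm_ge_id (s : 'S_k) : (forall i : 'I_k, i <= s i)%N -> s = 1%g.
Proof.
move=> h; apply/permP => i; rewrite perm1; apply: val_inj; apply/eqP.
have e : (\sum_(i < k) i = \sum_(i < k) s i)%N.
  exact: (reindex_inj (@perm_inj _ s)).
have [_ /esym] := leqif_sum (fun (i : 'I_k) (_ : true) => leqif_eq (h i)).
by rewrite e eqxx => /forallP/(_ i)/=; rewrite eq_sym.
Qed.

(** The vanishing theorem: for each permutation some point [y (t (s i))] is a zero of the falling
    power of exponent [a i]. *)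
Lemma falt_point_eq0 a t : strict a -> strict t ->
  ~~ [forall i, a i <= t i]%N -> falt y a [ffun j => y (t j)] = 0.
Proof.
move=> sa st nle; apply: big1 => s _.
have [i lt] : exists i, (t (s i) < a i)%N.
  apply/existsP; apply: contraNT nle; rewrite negb_exists => /forallP h.
  by apply/forallP; apply: (strict_perm_le (s := s)) => // i; rewrite leqNgt.
by rewrite /fmon (bigD1 i) //= !ffunE fpow_eq0 // mul0r mulr0.
Qed.

Lemma falt_point_diag a : strict a ->
  falt y a [ffun j => y (a j)] = \prod_j fpow y (a j) (y (a j)).
Proof.
move=> sa; rewrite /falt /alt (bigD1 1%g) //= odd_perm1 expr0 mul1r.
rewrite big1 ?addr0 => [|s ns]; first by apply: eq_bigr => j _; rewrite !ffunE perm1.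
have [i lt] : exists i, (s i < i)%N.
  apply/existsP; apply: contraNT ns; rewrite negb_exists => /forallP h.
  by apply/eqP/perm_ge_id => i; rewrite leqNgt.
have := strict_lt sa lt => alt'.
by rewrite /fmon (bigD1 i) //= !ffunE fpow_eq0 ?mul0r ?mulr0 //; lia.
Qed.

Lemma falt_base x :
  falt y (base_state k) x = \prod_(j < k) \prod_(i < k | (i < j)%N) (x i - x j).
Proof.
pose q e : {poly A} := \prod_(r < e) ((y r)%:P - 'X).
have szq e : (size (q e) <= e.+1)%N /\ (q e)`_e = (-1) ^+ e.
  elim: e => [|e [IH1 IH2]]; first by rewrite /q big_ord0 size_poly1 coef1.
  have -> : q e.+1 = q e * (y e)%:P - q e * 'X.
    by rewrite /q big_ord_recr /= mulrBr.
  have sz : (size (q e * (y e)%:P)%R <= e.+1)%N.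
    by rewrite mulrC mul_polyC (leq_trans (size_scale_leq _ _)).
  split.
    rewrite (leq_trans (size_polyD _ _)) // geq_max size_polyN.
    rewrite (leq_trans sz) //= (leq_trans (size_polyMleq _ _)) // size_polyX addn2.
    by rewrite ltnS.
  by rewrite coefB coefMX /= IH2 nth_default // sub0r exprS mulN1r.
have qE e u : (q e).[u] = fpow y e u.
  by rewrite horner_prod; apply: eq_bigr => r _; rewrite !hornerE.
(* The coefficient matrix of the falling powers is triangular with diagonal entries [(-1) ^+ i].
   These signs turn the Vandermonde factors [x j - x i] into [x i - x j]. *)
pose P := \matrix_(i < k, t < k) (q i)`_t.
have -> : falt y (base_state k) x = \det (P *m Vandermonde k (\row_j x j)).
  apply: eq_bigr => s _; congr (_ * _); apply: eq_bigr => i _.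
  rewrite !ffunE -qE (horner_coef_wide (n := k)); last first.
    by apply: leq_trans (proj1 (szq i)) _.
  by rewrite !mxE; apply: eq_bigr => t _; rewrite !mxE.
rewrite det_mulmx det_trig; last first.
  by apply/is_trig_mxP => i j ij; rewrite mxE nth_default // (leq_trans (proj1 (szq i))).
rewrite det_Vandermonde [X in _ * X](exchange_big_dep predT) //= -big_split /=.
apply: eq_bigr => j _; rewrite [P j j]mxE (proj2 (szq j)).
rewrite [RHS](eq_bigr (fun i : 'I_k => (-1) * (x j - x i))); last by move=> i _; ring.
rewrite big_split /= prodr_const; congr (_ ^+ _ * _); last first.
  by apply: eq_bigr => i _; rewrite !mxE.
rewrite -[LHS]card_ord -[in RHS]sum1_card.
by rewrite -(big_ord_widen _ (fun=> 1%N) (ltnW (ltn_ord j))) sum1_card card_ord.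
Qed.

Lemma tab_rmorph (A' : comNzRingType) (f : {rmorphism A -> A'}) L c
    (C : {set 'I_k}) x :
  f (tab y L c C x) = tab (fun r => f (y r)) L c C [ffun j => f (x j)].
Proof.
elim: L c C => [|l L IH] c C /=; first exact: rmorph1.
rewrite rmorph_sum; apply: eq_bigr => C' _; rewrite rmorphM IH; congr (_ * _).
by rewrite rmorph_prod; apply: eq_bigr => j _; rewrite rmorphB ffunE.
Qed.

Lemma eq_tab (y' : nat -> A) L c (C : {set 'I_k}) x : (forall r, y r = y' r) ->
  tab y L c C x = tab y' L c C x.
Proof.
move=> e; elim: L c C => //= l L IH c C; apply: eq_bigr => C' _.
by rewrite IH; congr (_ * _); apply: eq_bigr => j _; rewrite e.
Qed.

(** The coordinates of [x] are among [y 0, ..., y n.-1], all of them zeros of a falling power of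
    exponent at least [n]. *)
Lemma fmon_range_eq0 n a x (s : 'S_k) :
  (forall j : 'I_k, exists2 r, (r < n)%N & x j = y r) ->
  ~~ [forall j : 'I_k, (a j < n)%N] -> fmon y a (permx s x) = 0.
Proof.
move=> xE; rewrite negb_forall => /existsP[j]; rewrite -leqNgt => nj.
rewrite /fmon (bigD1 j) //= ffunE; have [r rn ->] := xE (s j).
by rewrite fpow_eq0 ?mul0r // (leq_trans rn).
Qed.

Lemma falt_range_eq0 n a x :
  (forall j : 'I_k, exists2 r, (r < n)%N & x j = y r) ->
  ~~ [forall j : 'I_k, (a j < n)%N] -> falt y a x = 0.
Proof.
by move=> xE an; apply: big1 => s _; rewrite (fmon_range_eq0 _ xE an) mulr0.
Qed.

End Values.

(** * Positivity of products of tableau sums and alternants *)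

Section Positivity.
Variables (A : comNzRingType) (k n : nat) (P : Type).
Variables (y : P -> nat -> A) (x : P -> {ffun 'I_k -> A}).
Hypothesis xE : forall p (j : 'I_k), exists2 r, (r < n)%N & x p j = y p r.
Variable cone : (P -> A) -> Prop.
Hypothesis cone_ext : forall h h', (forall p, h p = h' p) -> cone h -> cone h'.
Hypothesis cone0 : cone (fun=> 0).
Hypothesis coneD : forall h h', cone h -> cone h' -> cone (fun p => h p + h' p).
Hypothesis coneM : forall i e h, (i <= e)%N -> (e < n)%N -> cone h ->
  cone (fun p => (y p i - y p e) * h p).
Hypothesis cone_falt : forall a : {ffun 'I_k -> nat}, strict a ->
  (forall j : 'I_k, a j < n)%N -> cone (fun p => falt (y p) a (x p)).

Let cone_sum (I : finType) (Q : pred I) (h : I -> P -> A) :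
  (forall i, Q i -> cone (h i)) -> cone (fun p => \sum_(i | Q i) h i p).
Proof.
move=> hQ; elim: (index_enum I) => [|i r IH] /=.
  by apply: cone_ext cone0 => p; rewrite big_nil.
have [Qi|/negbTE Qi] := boolP (Q i); last first.
  by apply: cone_ext IH => p; rewrite big_cons Qi.
by apply: cone_ext (coneD (hQ i Qi) IH) => p; rewrite big_cons Qi.
Qed.

Let cone_prod (I : finType) (Q : pred I) (i e : I -> nat) h :
  (forall t, Q t -> (i t <= e t)%N && (e t < n)%N) -> cone h ->
  cone (fun p => (\prod_(t | Q t) (y p (i t) - y p (e t))) * h p).
Proof.
move=> hQ hh; elim: (index_enum I) => [|t r IH] /=.
  by apply: cone_ext hh => p; rewrite big_nil mul1r.
have [Qt|/negbTE Qt] := boolP (Q t); last first.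
  by apply: cone_ext IH => p; rewrite big_cons Qt.
have /andP[h1 h2] := hQ t Qt; apply: cone_ext (coneM h1 h2 IH) => p.
by rewrite big_cons Qt mulrA.
Qed.

Let fmon_out (a : {ffun 'I_k -> nat}) p (s : 'S_k) :
  ~~ [forall j : 'I_k, (a j < n)%N] -> fmon (y p) a (permx s (x p)) = 0.
Proof. exact: fmon_range_eq0. Qed.

(* A factor y_(c+gap) - y_(a_j) of the wrong sign would have to be preceded by
   a vanishing one: along the minima of successive columns, a_v - v - c can
   only decrease by steps of one, and only at a factor that is not raised. *)
Let cone_alt_tab L c (C : {set 'I_k}) (a : {ffun 'I_k -> nat}) : strict a ->
  (forall v j : 'I_k, j \in C -> (j <= v)%N -> (c + v <= a v)%N) ->
  cone (fun p => alt (fun x => tab (y p) L c C x * fmon (y p) a x) (x p)).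
Proof.
elim: L c C a => [|l L IH] c C a sa inv.
  have [/forallP an|/fmon_out an] := boolP [forall j : 'I_k, (a j < n)%N].
    by apply: cone_ext (cone_falt sa an) => p; apply: eq_alt => z; rewrite /= mul1r.
  by apply: cone_ext cone0 => p; rewrite /alt big1 // => s _; rewrite an !mulr0.
have [/forallP an|/fmon_out an] := boolP [forall j : 'I_k, (a j < n)%N]; last first.
  by apply: cone_ext cone0 => p; rewrite /alt big1 // => s _; rewrite an !mulr0.
apply: (@cone_ext (fun p => \sum_(C' : {set 'I_k} | col_le C' C && (#|C'| == l))
   \sum_(B : {set 'I_k} | (B \subset C') && strict (raise a B))
     step_weight (y p) c C' B a *
     alt (fun x => tab (y p) L c.+1 C' x * fmon (y p) (raise a B) x) (x p))).
  by move=> p; rewrite alt_tab_cons.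
apply: cone_sum => C' /andP[le _]; apply: cone_sum => B /andP[BC sr].
have [/existsP[j /andP[jCB /eqP jE]]|] :=
    boolP [exists j, (j \in C' :\: B) && (c + gap C' j == a j)%N].
  apply: cone_ext cone0 => p.
  by rewrite /step_weight (bigD1 j) //= jE subrr !mul0r.
rewrite negb_exists => /forallP nz; apply: cone_prod => [j|].
  rewrite inE an andbT => /andP[_ jC']; have [i iC ij] := col_le_min le jC'.
  by apply: leq_trans (inv _ _ iC ij); rewrite leq_add2l leq_subr.
apply: IH => // v j jC' jv; have [j0 [j0C' j0j gE _]] := min_gap jC'.
have [i iC ij] := col_le_min le j0C'; have aj0 := inv _ _ iC ij.
have : (c.+1 + j0 <= raise a B j0)%N.
  rewrite ffunE; have := nz j0; rewrite inE j0C' gE andbT.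
  by case: (j0 \in B) => /=; lia.
have j0v : (j0 <= v)%N by apply: leq_trans jv.
move: j0v; rewrite leq_eqVlt => /orP[/eqP/val_inj<- //|lt].
by have := strict_lt sr lt; lia.
Qed.

(** Before the first column the invariant of the column induction reads [v <= a v], which strictness
    gives. *)
Lemma cone_tab_falt L (a : {ffun 'I_k -> nat}) : strict a ->
  cone (fun p => tab (y p) L 0 setT (x p) * falt (y p) a (x p)).
Proof.
move=> sa; apply: (@cone_ext (fun p => alt _ _)) => [p|].
  by rewrite tab_falt.
by apply: cone_alt_tab => // v j _ _; rewrite add0n strict_ge.
Qed.

End Positivity.

(** * Schubert symbols and weights *)

Section SchubertSymbols.
Variables k n : nat.
Implicit Types (A B : schubert k n) (a : {ffun 'I_k -> nat}).

Definition positions A : {ffun 'I_k -> nat} := [ffun r => tnth A r : nat].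

Lemma positions_strict A : strict (positions A).
Proof.
apply/strictP => i j ij; rewrite !ffunE; case: A => t /= srt.
have x0 : 'I_n := tnth t i.
rewrite !(tnth_nth x0) -!(nth_map x0 0%N val) ?size_tuple // ij.
by apply: (sortedP 0%N srt); rewrite size_map size_tuple -ij.
Qed.

Lemma positions_lt A j : (positions A j < n)%N.
Proof. by rewrite ffunE. Qed.

Lemma positions_inj : injective positions.
Proof.
move=> A B /ffunP e; apply/val_inj/eq_from_tnth => i; apply: val_inj.
by have := e i; rewrite !ffunE.
Qed.

Lemma tnth_inj A : injective (tnth A).
Proof.
move=> i j e; apply/eqP; rewrite -val_eqE /=.
have e' : positions A i = positions A j by rewrite !ffunE e.
by case: ltngtP => // h; have := strict_lt (positions_strict A) h; rewrite e'; lia.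
Qed.

Lemma ssetP A x : reflect (exists r, x = tnth A r) (x \in sset A).
Proof. by rewrite inE; apply: tnthP. Qed.

Lemma tnth_sset A r : tnth A r \in sset A.
Proof. by apply/ssetP; exists r. Qed.

Lemma sset_imset A : sset A = [set tnth A r | r : 'I_k].
Proof.
apply/setP => x; apply/ssetP/imsetP => [[r ->]|[r _ ->]]; by exists r.
Qed.

Lemma card_sset A : #|sset A| = k.
Proof. by rewrite sset_imset card_imset ?card_ord //; apply: tnth_inj. Qed.

Lemma big_sset (T : Type) (idx : T) (op : Monoid.com_law idx) A (F : 'I_n -> T) :
  \big[op/idx]_(x in sset A) F x = \big[op/idx]_(r < k) F (tnth A r).
Proof.
by rewrite sset_imset big_imset //; apply: in2W; apply: tnth_inj.
Qed.

Lemma transport_perm A B (phi : 'I_n -> 'I_n) :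
  {in sset A, forall x, phi x \in sset B} -> {in sset A &, injective phi} ->
  exists s : 'S_k, forall r, tnth B (s r) = phi (tnth A r).
Proof.
move=> hB inj.
have h r : exists r', tnth B r' = phi (tnth A r).
  by have /ssetP[r' ->] := hB _ (tnth_sset A r); exists r'.
have [f fE] := fin_all_exists h.
have finj : injective f.
  move=> i j e; apply: (@tnth_inj A); apply: inj; rewrite ?tnth_sset //.
  by rewrite -!fE e.
by exists (perm finj) => r; rewrite permE.
Qed.

(** The images of the entries of [A] are the entries of [B] in some order, and sorting preserves the
    inequalities. *)
Lemma bruhat_transport A B (phi : 'I_n -> 'I_n) :
  {in sset A, forall x, phi x \in sset B} -> {in sset A &, injective phi} ->
  (forall x : 'I_n, x <= phi x)%N -> bruhat A B.
Proof.
move=> hB inj le; have [s sE] := transport_perm hB inj.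
apply/forallP => r; have := @strict_perm_le k (positions A) (positions B) s.
move=> /(_ (positions_strict _) (positions_strict _)) h.
have := h _ r; rewrite !ffunE; apply => i; rewrite !ffunE sE; exact: le.
Qed.

Lemma sset_inj : injective (@sset k n).
Proof.
move=> A B e; apply: positions_inj; apply/ffunP => r.
have hA : bruhat A B by apply: (@bruhat_transport _ _ id) => // x; rewrite e.
have hB : bruhat B A by apply: (@bruhat_transport _ _ id) => // x; rewrite e.
have := forallP hA r; have := forallP hB r; rewrite !ffunE => h1 h2.
by apply/eqP; rewrite eqn_leq h1 h2.
Qed.

Lemma sset_surj (Z : {set 'I_n}) : #|Z| = k -> exists A, sset A = Z.
Proof.
move=> Zk; have szZ : size (enum Z) == k by rewrite -cardE Zk.
have srt : sorted ltn [seq val x | x <- Tuple szZ].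
  rewrite sorted_map /= /enum_mem; apply: sorted_filter.
    by move=> x y z; apply: ltn_trans.
  have := iota_ltn_sorted 0 n; rewrite -val_enum_ord sorted_map.
  by rewrite enumT.
exists (Schubert srt); apply/setP => x.
by rewrite inE /= mem_enum.
Qed.

Lemma positions_surj a : strict a -> (forall j, a j < n)%N ->
  exists A, positions A = a.
Proof.
move=> sa an; pose f j := Ordinal (an j).
have srt : sorted ltn [seq val x | x <- [tuple f j | j < k]].
  apply/(sortedP 0%N) => i; rewrite size_map size_tuple => ik.
  have k0 : 'I_k by exists i.+1.
  rewrite -map_comp (nth_map k0) ?size_enum_ord 1?ltnW //.
  rewrite (nth_map k0) ?size_enum_ord //=.
  by apply: (strictP _ sa); rewrite !nth_enum_ord // ltnW.
exists (Schubert srt); apply/ffunP => j; rewrite ffunE /=.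
by rewrite tnth_mktuple.
Qed.

Lemma exchange_sset A s s' : s \in sset A -> s' \notin sset A ->
  exists B, sset B = s' |: (sset A :\ s).
Proof.
move=> sA s'A; apply: sset_surj.
have := cardsD1 s (sset A); rewrite sA card_sset => kE.
by rewrite cardsU1 in_setD1 (negbTE s'A) andbF -kE.
Qed.

Section Exchange.
Variables (A B : schubert k n) (s s' : 'I_n).
Hypothesis s'A : s' \notin sset A.
Hypothesis BE : sset B = s' |: (sset A :\ s).

Let swap x := if x == s then s' else x.

Let swap_in : {in sset A, forall x, swap x \in sset B}.
Proof.
move=> x xA; rewrite BE in_setU1 in_setD1 /swap.
by case: (eqVneq x s) => [_|ns]; rewrite ?eqxx // ns xA orbT.
Qed.

Let swap_inj : {in sset A &, injective swap}.
Proof.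
move=> x x' xA x'A; rewrite /swap.
case: eqP => [->|_]; case: eqP => [->|_] // e; move: s'A.
  by rewrite e x'A.
by rewrite -e xA.
Qed.

Lemma exchange_bruhat : (s <= s')%N -> bruhat A B.
Proof.
move=> le; apply: (bruhat_transport swap_in swap_inj) => x.
by rewrite /swap; case: eqP => [->|].
Qed.

Lemma exchange_perm : exists sg : 'S_k, forall r,
  tnth B (sg r) = if tnth A r == s then s' else tnth A r.
Proof. exact: transport_perm swap_in swap_inj. Qed.

End Exchange.

Lemma positions_raise A B (t : 'I_k) :
  positions B = raise (positions A) [set t] ->
  [/\ tnth B t = (tnth A t).+1 :> nat, tnth B t \notin sset A &
      sset B = tnth B t |: (sset A :\ tnth A t)].
Proof.
move=> /ffunP e; have e1 r : tnth B r = (tnth A r + (r == t))%N :> nat.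
  by have := e r; rewrite !ffunE inE.
have e2 r : r != t -> tnth B r = tnth A r.
  by move=> rt; apply: val_inj; rewrite /= e1 (negbTE rt) addn0.
have nB : tnth B t \notin sset A.
  apply/negP => /ssetP[r rE]; have [rt|rt] := eqVneq r t.
    by have := e1 t; rewrite rE rt eqxx; lia.
  by move: rE; rewrite -e2 // => /tnth_inj rt'; rewrite rt' eqxx in rt.
split=> //; first by rewrite e1 eqxx addn1.
apply/setP => x; rewrite in_setU1 in_setD1; apply/idP/idP => [/ssetP[r ->]|].
  have [->|rt] := eqVneq r t; first by rewrite eqxx.
  by rewrite e2 // tnth_sset (inj_eq (@tnth_inj A)) rt orbT.
case/orP => [/eqP->|/andP[ne /ssetP[r rE]]]; first exact: tnth_sset.
have rt : r != t by apply: contraNneq ne => <-; rewrite rE.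
by rewrite rE -e2 // tnth_sset.
Qed.

Lemma strict_lower (a : {ffun 'I_k -> nat}) : strict a -> a != base_state k ->
  exists (t : 'I_k) (a' : {ffun 'I_k -> nat}), strict a' /\ a = raise a' [set t].
Proof.
move=> sa ne.
have [j0 j0P] : exists j : 'I_k, (j < a j)%N.
  apply/existsP; apply: contraNT ne; rewrite negb_exists => /forallP h.
  apply/eqP/ffunP => j; rewrite ffunE; apply/eqP.
  by rewrite eqn_leq strict_ge // andbT leqNgt.
(* Below the first index [t] with [t < a t] the exponents equal their indices, so lowering [a t] by
   one keeps strictness. *)
have [t tP tmin] := @arg_minnP _ j0 (fun j : 'I_k => (j < a j)%N)
  (fun j : 'I_k => j : nat) j0P.
exists t, [ffun j => (a j - (j == t))%N]; split; last first.
  apply/ffunP => j; rewrite !ffunE inE; case: eqP => [->|_] /=; last by rewrite subn0 addn0.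
  by rewrite subnK // (leq_trans _ tP).
apply/strictP => i j ij; rewrite !ffunE; have := strictP _ sa i j ij.
case: (eqVneq j t) => [jt|_]; last by lia.
have -> : (i == t) = false by rewrite -jt -val_eqE /=; lia.
have := strict_ge i sa; have := tmin i; rewrite -jt in tP *; move: tP; rewrite ij.
by case: (ltnP i (a i)) => [_ _ /(_ isT)|] /=; lia.
Qed.

End SchubertSymbols.

Lemma weight_dvd m (b : 'I_m.+1 -> nat) (i j : 'I_m.+1) :
  div_chain b -> (i <= j)%N -> (b j %| b i)%N.
Proof.
move=> hchain ij; have [d dE] : exists d, (j = i + d :> nat)%N by exists (j - i)%N; lia.
elim: d j dE {ij} => [|d IH] j dE.
  by have -> : j = i by apply: val_inj; rewrite /= dE addn0.
have j'm : (i + d < m.+1)%N by rewrite (leq_trans _ (ltn_ord j)) // dE; lia.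
apply: dvdn_trans (IH (Ordinal j'm) erefl); apply: hchain.
by rewrite dE addnS.
Qed.

(** * Additive splitting of Plücker weights *)

Section Weights.
Variables (k n m : nat) (lam : 'I_m.+1 -> schubert k n) (b : 'I_m.+1 -> nat).
Hypotheses (k_gt0 : (0 < k)%N) (k_lt_n : (k < n)%N).
Hypotheses (hlam : schubert_order lam) (hb : plucker_weight lam b).
Hypothesis hchain : div_chain b.

Lemma lam_inj : injective lam.
Proof. by case: hlam => /bij_inj. Qed.

Lemma lam_surj (A : schubert k n) : exists i, lam i = A.
Proof. by case: hlam => -[f _ fK] _; exists (f A). Qed.

Lemma lam_positions (a : {ffun 'I_k -> nat}) : strict a -> (forall j, a j < n)%N ->
  exists i, positions (lam i) = a.
Proof.
move=> sa an; have [A <-] := positions_surj sa an.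
by have [i <-] := lam_surj A; exists i.
Qed.

Lemma bruhat_le i j : bruhat (lam i) (lam j) -> (i <= j)%N.
Proof. by case: hlam => _; apply. Qed.

Lemma weight_gt0 i : (0 < b i)%N.
Proof. by case: hb. Qed.

Lemma weight_le (i j : 'I_m.+1) : (i <= j)%N -> (b j <= b i)%N.
Proof. by move=> /(weight_dvd hchain); apply: dvdn_leq; apply: weight_gt0. Qed.

(** The symbol with positions [0, ..., k-1] lies below all others, so the total order puts it
    first. *)
Lemma positions_lam0 : positions (lam ord0) = base_state k.
Proof.
have [|j|i iE] := @lam_positions (base_state k).
- by apply/strictP => i j ij; rewrite !ffunE ij.
- by rewrite ffunE (ltn_trans _ k_lt_n).
have le : bruhat (lam i) (lam ord0).
  apply/forallP => r; have /ffunP/(_ r) := iE; rewrite !ffunE => ->.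
  by have := strict_ge r (positions_strict (lam ord0)); rewrite ffunE.
have := bruhat_le le; rewrite leqn0 => /eqP i0.
by have <- : i = ord0 by apply: val_inj.
Qed.

Let simple_exchange (s s' : 'I_n) (ij : 'I_m.+1 * 'I_m.+1) : bool :=
  [&& s \in sset (lam ij.1), s' \notin sset (lam ij.1) &
      sset (lam ij.2) == s' |: (sset (lam ij.1) :\ s)].

(** The drop in weight caused by replacing [s] by [s'] does not depend on the symbol. It is
    non-negative because weights decrease along the total order. *)
Let simple_diff (s s' : 'I_n) : (s < s')%N -> exists d : nat,
  forall ij, simple_exchange s s' ij -> b ij.1 = (b ij.2 + d)%N.
Proof.
move=> ss'.
have [/existsP[ij0 h0]|] := boolP [exists ij, simple_exchange s s' ij]; last first.
  by rewrite negb_exists => /forallP h; exists 0%N => ij; rewrite (negbTE (h ij)).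
exists (b ij0.1 - b ij0.2)%N => ij /and3P[si s'i /eqP jE].
move: h0 => /and3P[si0 s'i0 /eqP j0E].
have nss' : s != s' by rewrite -val_eqE /= neq_ltn ss'.
have le : (b ij0.2 <= b ij0.1)%N.
  apply: weight_le; apply: bruhat_le.
  exact: (exchange_bruhat s'i0 j0E (ltnW ss')).
(* The Plücker relation for [sset (lam ij.1) :\ s] and this set reads
   [b ij.1 + b ij0.2 = b ij.2 + b ij0.1]. *)
pose B := s' |: sset (lam ij0.1).
have := proj2 hb (sset (lam ij.1) :\ s) B s s' ij.1 ij0.2 ij.2 ij0.1.
have c1 : #|sset (lam ij.1) :\ s|.+1 = k.
  by have := cardsD1 s (sset (lam ij.1)); rewrite si card_sset.
have c2 : #|B| = k.+1 by rewrite cardsU1 s'i0 card_sset.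
have c3 : s \in B :\: (sset (lam ij.1) :\ s).
  by rewrite in_setD in_setD1 eqxx in_setU1 si0 orbT.
have c4 : s' \in B :\: (sset (lam ij.1) :\ s).
  by rewrite in_setD in_setD1 (negbTE s'i) andbF setU11.
have c5 : sset (lam ij.1) = s |: (sset (lam ij.1) :\ s) by rewrite setD1K.
have c6 : sset (lam ij0.2) = B :\ s.
  rewrite j0E; apply/setP => x; rewrite in_setU1 !in_setD1 in_setU1.
  by case: (eqVneq x s) => [->|] //=; rewrite (negbTE nss').
have c7 : sset (lam ij0.1) = B :\ s' by rewrite setU1K.
by move=> /(_ c1 c2 c3 c4 c5 c6 jE c7); lia.
Qed.

(** Here [d t] is the drop when [t] is replaced by [t.+1], and [D r] the total drop from 0 to [r];
    then [w r = w0 - D r] decreases. *)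
Lemma weight_split : exists w : nat -> rat,
  (forall i, (b i)%:R = \sum_(r < k) w (tnth (lam i) r)) /\
  (forall i e, (i <= e)%N -> (e < n)%N -> w e <= w i).
Proof.
have h (r : 'I_n) : exists d : nat, forall s' : 'I_n, s' = r.+1 :> nat ->
    forall ij, simple_exchange r s' ij -> b ij.1 = (b ij.2 + d)%N.
  have [rn|rn] := ltnP r.+1 n; last by exists 0%N => s' s'E; have := ltn_ord s'; lia.
  have [d dP] := @simple_diff r (Ordinal rn) (leqnn _).
  exists d => s' s'E; have -> : s' = Ordinal rn by apply: val_inj.
  exact: dP.
have [d dP] := fin_all_exists h.
pose dn t : nat := if insub t is Some r then d r else 0%N.
pose D r : nat := (\sum_(t < r) dn t)%N.
(* Chosen so that [w0 - D r] for [r < k] adds up to [b ord0]; the division by [k] is why [w] is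
   rational. *)
pose w0 : rat := (b ord0 + \sum_(r < k) D r)%N%:R / k%:R.
exists (fun r => w0 - (D r)%:R); split=> [i|i e ie en]; last first.
  rewrite lerD2l lerN2 ler_nat /D -(subnKC ie) big_split_ord /=.
  exact: leq_addr.
(* Induction on the sum of the entries: lowering one entry by one changes both sides by the same
   drop. *)
have [N] := ubnP (\sum_(r < k) tnth (lam i) r)%N.
elim: N i => // N IH i; rewrite ltnS => iN.
have [iE|ne] := eqVneq (positions (lam i)) (base_state k).
  have -> : i = ord0 by apply/lam_inj/positions_inj; rewrite positions_lam0.
  have tE r : tnth (lam ord0) r = r :> nat.
    by have /ffunP/(_ r) := positions_lam0; rewrite !ffunE.
  rewrite (eq_bigr (fun r : 'I_k => w0 - (D r)%:R)) => [|r _]; last by rewrite tE.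
  rewrite big_split /= sumr_const card_ord -[w0 *+ k]mulr_natr /w0 divfK; last first.
    by rewrite pnatr_eq0 -lt0n.
  by rewrite natrD natr_sum sumrN addrK.
have [t [a' [sa' aE]]] := strict_lower (positions_strict _) ne.
have [|j jE] := lam_positions sa'.
  move=> r; apply: leq_ltn_trans (positions_lt (lam i) r).
  by rewrite aE [raise _ _ _]ffunE leq_addr.
rewrite -jE in aE; have [h1 h2 h3] := positions_raise aE.
have bE := dP _ _ h1 (j, i); rewrite /simple_exchange /= tnth_sset h2 h3 eqxx in bE.
have e1 r : r != t -> tnth (lam i) r = tnth (lam j) r.
  move=> rt; apply: val_inj => /=; have /ffunP/(_ r) := aE.
  by rewrite !ffunE inE (negbTE rt) addn0.
have := IH j; rewrite {}bE // => /(_ _).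
have lt : (\sum_(r < k) tnth (lam j) r < N)%N.
  apply: leq_trans iN; rewrite (bigD1 t) //= [X in (_ < X)%N](bigD1 t) //= h1.
  rewrite addSn ltnS leq_add2l leq_eqVlt; apply/orP; left.
  by apply/eqP/eq_bigr => r /e1->.
move=> /(_ lt); rewrite (bigD1 t) //= [in X in _ -> X](bigD1 t) //= h1.
rewrite (eq_bigr (fun r => w0 - (D (tnth (lam i) r))%:R)); last by move=> r /e1->.
have -> : D (tnth (lam j) t).+1 = (D (tnth (lam j) t) + d (tnth (lam j) t))%N.
  by rewrite /D big_ord_recr /= /dn valK.
by rewrite !natrD => e; rewrite -[(b i)%:R](addrK (d (tnth (lam j) t))%:R) e; ring.
Qed.

End Weights.

(** * Restrictions to fixed points *)

Section Elimination.
Variables (n : nat) (R : comNzRingType).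
Implicit Types (e f : {mpoly R[n]}) (s : 'I_n).

Let congr_mod e f g := exists q, f = g + q * e.

Let congr_modD e f g f' g' :
  congr_mod e f g -> congr_mod e f' g' -> congr_mod e (f + f') (g + g').
Proof. by move=> [q ->] [q' ->]; exists (q + q'); ring. Qed.

Let congr_modM e f g f' g' :
  congr_mod e f g -> congr_mod e f' g' -> congr_mod e (f * f') (g * g').
Proof. by move=> [q ->] [q' ->]; exists (q * g' + q' * g + q * q' * e); ring. Qed.

Let congr_mod_refl e f : congr_mod e f f.
Proof. by exists 0; rewrite mul0r addr0. Qed.

Lemma comp_mpoly_congr e (lp lq : n.-tuple {mpoly R[n]}) f :
  (forall i, exists q, tnth lp i = tnth lq i + q * e) ->
  exists q, f \mPo lp = f \mPo lq + q * e.
Proof.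
move=> h; rewrite !comp_mpolyE.
apply: (big_ind2 (congr_mod e)); [exact: congr_mod_refl|exact: congr_modD|].
move=> mu _; rewrite -!mul_mpolyC; apply: congr_modM; first exact: congr_mod_refl.
apply: (big_ind2 (congr_mod e)); [exact: congr_mod_refl|exact: congr_modM|].
move=> i _; elim: (mu i) => [|d IH]; first by rewrite !expr0; apply: congr_mod_refl.
by rewrite !exprS; apply: congr_modM.
Qed.

(* When X_s occurs in e with coefficient 1, this is reduction modulo e. *)
Definition elim_var s e : {mpoly R[n]} -> {mpoly R[n]} :=
  comp_mpoly [tuple if i == s then 'X_i - e else 'X_i | i < n].

HB.instance Definition _ s e := GRing.RMorphism.copy (elim_var s e)
  (comp_mpoly [tuple if i == s then 'X_i - e else 'X_i | i < n]).

Lemma elim_varX s e i : elim_var s e 'X_i = if i == s then 'X_i - e else 'X_i.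
Proof. by rewrite /elim_var comp_mpolyXU -tnth_nth tnth_mktuple. Qed.

Lemma elim_var_mod s e f : exists q, f = elim_var s e f + q * e.
Proof.
have [|q] := @comp_mpoly_congr e [tuple 'X_i | i < n]
    [tuple if i == s then 'X_i - e else 'X_i | i < n] f.
  move=> i; rewrite !tnth_mktuple; case: ifP => _; last by exists 0; ring.
  by exists 1; ring.
by rewrite comp_mpoly_id => e1; exists q.
Qed.

End Elimination.

Section DivideByProduct.
Variables (n : nat) (R : idomainType) (T : eqType).
Variables (e : T -> {mpoly R[n]}) (s : T -> 'I_n).

(** Write [f] as [q] times the product over the tail. Eliminating along [e t] kills [f] but no
    factor of that product, so it kills [q], and [e t] divides [q]. *)
Lemma dvd_prod_elim f (r : seq T) : uniq r ->
  {in r, forall t, elim_var (s t) (e t) (e t) = 0} ->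
  {in r &, forall t u, t != u -> elim_var (s t) (e t) (e u) != 0} ->
  {in r, forall t, elim_var (s t) (e t) f = 0} ->
  exists q, f = q * \prod_(t <- r) e t.
Proof.
elim: r => [|t r IH] /=; first by exists f; rewrite big_nil mulr1.
case/andP=> tr ur h1 h2 h3; have [||||q qE] := IH.
- exact: ur.
- by move=> u ur'; apply: h1; rewrite inE ur' orbT.
- by move=> u v ur' vr; apply: h2; rewrite inE ?ur' ?vr orbT.
- by move=> u ur'; apply: h3; rewrite inE ur' orbT.
have nz : \prod_(u <- r) elim_var (s t) (e t) (e u) != 0.
  rewrite prodf_seq_neq0; apply/allP => u ur'; apply: h2; rewrite ?inE ?eqxx ?ur' ?orbT //.
  by apply: contraNneq tr => ->.
have := h3 t; rewrite inE eqxx {1}qE => /(_ isT)/eqP.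
rewrite rmorphM rmorph_prod mulf_eq0 (negbTE nz) orbF => /eqP q0.
have [q' q'E] := elim_var_mod (s t) (e t) q; exists q'.
by rewrite qE q'E q0 add0r big_cons mulrA.
Qed.

End DivideByProduct.

(** * Factorial Schur polynomials at the fixed points *)

Section WeightedPoints.
Variables (k n m : nat) (lam : 'I_m.+1 -> schubert k n) (b : 'I_m.+1 -> nat).
Hypotheses (hlam : schubert_order lam) (hb : plucker_weight lam b).
Hypothesis hchain : div_chain b.
Variable w : nat -> rat.
Hypothesis hw : forall i, (b i)%:R = \sum_(r < k) w (tnth (lam i) r).
Notation A := {mpoly rat[n]}.
Implicit Types (i l p : 'I_m.+1).

Definition varq (r : nat) : A := if insub r is Some r' then 'X_r' else 0.

Lemma varqE (r : 'I_n) : varq r = 'X_r.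
Proof. by rewrite /varq valK. Qed.

Definition Yq p : A := \sum_(r < k) 'X_(tnth (lam p) r).

Definition ypt p (r : nat) : A := varq r - (w r / (b p)%:R) *: Yq p.

Definition xpt p : {ffun 'I_k -> A} := [ffun j => ypt p (positions (lam p) j)].

Definition edgeq l p : A := Yq l - ((b l)%:R / (b p)%:R) *: Yq p.

Definition schub l p : A :=
  tab (ypt p) (col_sizes (positions (lam l)) n) 0 setT (xpt p).

Definition faltq l p : A := falt (ypt p) (positions (lam l)) (xpt p).

(** The denominator of the bialternant formula at [p], common to all classes. *)
Definition vdm p : A := falt (ypt p) (base_state k) (xpt p).

Let bq_neq0 p : (b p)%:R != 0 :> rat.
Proof. by rewrite pnatr_eq0 -lt0n (weight_gt0 hb). Qed.

Lemma xptE p j : xpt p j = ypt p (tnth (lam p) j).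
Proof. by rewrite !ffunE. Qed.

Lemma schub_vdm l p : schub l p * vdm p = faltq l p.
Proof.
apply: tab_shape_base; first exact: positions_strict.
by move=> j; apply/ltnW/positions_lt.
Qed.

Lemma sum_ypt l p : \sum_(r < k) ypt p (tnth (lam l) r) = edgeq l p.
Proof.
rewrite sumrB; congr (_ - _); first by apply: eq_bigr => r _; rewrite varqE.
by rewrite -scaler_suml -mulr_suml -hw.
Qed.

(** With this centring at [p] the multiplier in the one-box Pieri rule is exactly the edge form. *)
Lemma sum_xpt p : \sum_j xpt p j = 0.
Proof.
rewrite (eq_bigr _ (fun j _ => xptE p j)) sum_ypt /edgeq divff ?bq_neq0 //.
by rewrite scale1r subrr.
Qed.

(** The shifted variables at [p] and [l] agree modulo the edge form; the divisibility conditions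
    rest on this. *)
Lemma ypt_edge l p r : ypt p r = ypt l r + (w r / (b l)%:R) *: edgeq l p.
Proof.
rewrite /ypt /edgeq scalerBr scalerA.
have -> : w r / (b l)%:R * ((b l)%:R / (b p)%:R) = w r / (b p)%:R.
  by rewrite mulrA divfK ?bq_neq0.
by ring.
Qed.

Lemma coef_Yq p (s : 'I_n) : (Yq p)@_U_(s) = (s \in sset (lam p))%:R.
Proof.
rewrite /Yq -(big_sset _ (lam p) (fun x => 'X_x : A)) raddf_sum /=.
under eq_bigr do rewrite mcoeffXU.
have [sp|sp] := boolP (s \in _).
  rewrite (bigD1 s) //= eqxx big1 ?addr0 // => i /andP[_ ne].
  by rewrite (negbTE ne).
by rewrite big1 // => i ip; case: eqP => // e; rewrite -e ip in sp.
Qed.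

Lemma coef_ypt p r (s : 'I_n) : (r < n)%N ->
  (ypt p r)@_U_(s) = (r == s)%:R - w r / (b p)%:R * (s \in sset (lam p))%:R.
Proof.
move=> rn; rewrite -[r]/(val (Ordinal rn)) /ypt varqE mcoeffB mcoeffZ coef_Yq.
by rewrite mcoeffXU.
Qed.

(** If the difference vanished, its coefficients at [r] and [r'] would give [2 = 0] or [1 = 0],
    according to whether [r] is in the symbol. *)
Lemma ypt_diff_neq0 p (r r' : 'I_n) : r != r' -> r' \in sset (lam p) ->
  ypt p r - ypt p r' != 0.
Proof.
move=> ne r'p; apply/eqP => e0.
have h (s : 'I_n) : (ypt p r)@_U_(s) - (ypt p r')@_U_(s) = 0.
  by rewrite -mcoeffB e0 mcoeff0.
have := h r; have := h r'; rewrite !coef_ypt // !eqxx r'p mulr1.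
have -> : (r == r' :> nat) = false by apply/negbTE.
have -> : (r' == r :> nat) = false by rewrite eq_sym; apply/negbTE.
set u := _ / _; set v := _ / _; case: (_ \in _) => /= h1 h2.
  have : 2%:R = 0 :> rat by lra.
  by [].
by have : 1 = 0 :> rat by lra.
Qed.

Section Exchange.
Variables (l p : 'I_m.+1) (s s' : 'I_n).
Hypotheses (sp : s \notin sset (lam p)) (s'p : s' \in sset (lam p)).
Hypothesis (lE : sset (lam l) = s |: (sset (lam p) :\ s')).

Let ss' : s != s'.
Proof. by apply: contraNneq sp => ->. Qed.

Lemma exchange_sum (V : zmodType) (G : 'I_n -> V) :
  \sum_(r < k) G (tnth (lam l) r) = \sum_(r < k) G (tnth (lam p) r) + G s - G s'.
Proof.
rewrite -!(big_sset _ _ G) lE big_setU1; last by rewrite in_setD1 (negbTE sp) andbF.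
by rewrite [X in _ = X + _ - _](big_setD1 s') //= addrC addrAC [G s' + _]addrC addrK.
Qed.

Lemma edgeq_exchange : edgeq l p = ypt p s - ypt p s'.
Proof.
rewrite /edgeq /Yq (exchange_sum (fun r => 'X_r : A)) !hw.
rewrite (exchange_sum (fun r => w r)) -!hw /ypt !varqE -/(Yq p).
rewrite !mulrDl mulNr divff ?bq_neq0 // !scalerDl scale1r scaleNr.
ring.
Qed.

(** ['X_s] has coefficient 1 in the edge form and, as [s] is not in [lam p], does not occur in
    [Yq p]. *)
Lemma elim_edgeq : elim_var s (edgeq l p) (edgeq l p) = 0.
Proof.
have EE : edgeq l p = 'X_s - 'X_s' - ((w s - w s') / (b p)%:R) *: Yq p.
  by rewrite edgeq_exchange /ypt !varqE mulrBl scalerBl; ring.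
rewrite [X in elim_var _ _ X]EE.
have YE : elim_var s (edgeq l p) (Yq p) = Yq p.
  rewrite rmorph_sum; apply: eq_bigr => r _ /=; rewrite elim_varX.
  by case: eqP => // e; have := tnth_sset (lam p) r; rewrite e (negbTE sp).
rewrite -mul_mpolyC !rmorphB rmorphM /= YE !elim_varX eqxx eq_sym (negbTE ss').
by rewrite [elim_var _ _ _%:MP]comp_mpolyC mul_mpolyC {1}EE; ring.
Qed.

Lemma elim_ypt (r : nat) :
  elim_var s (edgeq l p) (ypt p r) = elim_var s (edgeq l p) (ypt l r).
Proof.
rewrite (ypt_edge l) rmorphD /= -mul_mpolyC rmorphM /= elim_edgeq.
by rewrite mulr0 addr0.
Qed.

(** Modulo the edge form the parameters at [p] and [l] coincide and the points [xpt p] and [xpt l]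
    differ by a permutation, under which the tableau sum is symmetric. *)
Lemma elim_schub i :
  elim_var s (edgeq l p) (schub i p) = elim_var s (edgeq l p) (schub i l).
Proof.
rewrite /schub !tab_rmorph.
rewrite (eq_tab _ _ _ _ elim_ypt).
have [sg sgE] := exchange_perm sp lE.
rewrite -[RHS](tab_setT_sym _ _ _ sg); congr tab; apply/ffunP => r.
rewrite !ffunE sgE; case: eqP => [->|_]; last exact: elim_ypt.
rewrite /= -elim_ypt; apply/eqP; rewrite -subr_eq0 -opprB oppr_eq0 -rmorphB /=.
by rewrite -edgeq_exchange elim_edgeq.
Qed.

End Exchange.

Lemma rset_exchange l p : l \in Rset lam p -> exists ss : 'I_n * 'I_n,
  [/\ ss.1 \notin sset (lam p), ss.2 \in sset (lam p), (ss.1 < ss.2)%N &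
      sset (lam l) = ss.1 |: (sset (lam p) :\ ss.2)].
Proof.
rewrite !inE => /existsP[s /existsP[s' /and4P[sl s'l ss' /eqP pE]]].
have ns : s != s' by rewrite -val_eqE /= neq_ltn ss'.
exists (s, s') => /=; split=> //.
- by rewrite pE in_setU1 in_setD1 eqxx (negbTE ns).
- by rewrite pE setU11.
- by rewrite pE setU1K ?setD1K // in_setD1 (negbTE s'l) andbF.
Qed.

Lemma exchange_rset l p (s s' : 'I_n) : s \notin sset (lam p) ->
  s' \in sset (lam p) -> (s < s')%N ->
  sset (lam l) = s |: (sset (lam p) :\ s') -> l \in Rset lam p.
Proof.
move=> sp s'p ss' lE; rewrite !inE; apply/existsP; exists s; apply/existsP; exists s'.
have ns : s' != s by rewrite -val_eqE /= neq_ltn ss' orbT.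
apply/and4P; split=> //.
- by rewrite lE setU11.
- by rewrite lE in_setU1 in_setD1 eqxx (negbTE ns).
- by apply/eqP; rewrite lE setU1K ?setD1K // in_setD1 (negbTE sp) andbF.
Qed.

(** Elements of [Rset lam p] correspond bijectively to pairs [s < s'] with [s'] in and [s] outside
    [lam p]. *)
Lemma big_rset (T : Type) (idx : T) (op : Monoid.com_law idx) p
    (G : 'I_m.+1 -> T) (H : 'I_n -> 'I_n -> T) :
  (forall l s s', s \notin sset (lam p) -> s' \in sset (lam p) ->
     sset (lam l) = s |: (sset (lam p) :\ s') -> G l = H s s') ->
  \big[op/idx]_(l in Rset lam p) G l =
  \big[op/idx]_(s' in sset (lam p))
    \big[op/idx]_(s : 'I_n | (s < s')%N && (s \notin sset (lam p))) H s s'.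
Proof.
move=> GH; pose Q := [set pr : 'I_n * 'I_n | (pr.2 \in sset (lam p)) &&
  ((pr.1 < pr.2)%N && (pr.1 \notin sset (lam p)))].
have hex (pr : 'I_n * 'I_n) : exists l, pr \in Q ->
    sset (lam l) = pr.1 |: (sset (lam p) :\ pr.2).
  have [|nQ] := boolP (pr \in Q); last by exists p.
  rewrite inE => /and3P[h1 _ h2]; have [B BE] := exchange_sset h1 h2.
  by have [l lE] := lam_surj hlam B; exists l => _; rewrite lE.
have [h hE] := fin_all_exists hex.
have hinj : {in Q &, injective h}.
  move=> u v uQ vQ e; have := hE v vQ; rewrite -e hE // => e2.
  move: uQ vQ; rewrite inE => /and3P[u2 _ u1]; rewrite inE => /and3P[v2 _ v1].
  have e1 : u.1 = v.1.
    have := setU11 u.1 (sset (lam p) :\ u.2).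
    by rewrite e2 in_setU1 in_setD1 (negbTE u1) andbF orbF => /eqP.
  have e3 : u.2 = v.2.
    have : u.2 \notin u.1 |: (sset (lam p) :\ u.2).
      rewrite in_setU1 in_setD1 eqxx orbF; apply: contraNneq u1 => <-.
      by [].
    rewrite e2 in_setU1 in_setD1 u2 andbT negb_or => /andP[_].
    by rewrite negbK => /eqP.
  by case: u v e1 e3 {u1 u2 v1 v2 e e2} => [? ?] [? ?] /= -> ->.
have -> : Rset lam p = [set h pr | pr in Q].
  apply/setP => l; apply/idP/imsetP => [lp|[pr prQ ->]].
    have [ss [h1 h2 h3 h4]] := rset_exchange lp.
    have ssQ : ss \in Q by rewrite inE h2 h3.
    exists ss => //; apply: (lam_inj hlam); apply: sset_inj.
    by rewrite h4 -hE.
  have := hE pr prQ; move: prQ; rewrite inE => /and3P[h1 h2 h3].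
  exact: exchange_rset.
rewrite big_imset // pair_big_dep /= (reindex (fun pr : 'I_n * 'I_n => (pr.2, pr.1))) /=.
  apply: eq_big => [pr|pr prQ]; first by rewrite inE.
  have := hE _ prQ; move: prQ; rewrite inE /= => /and3P[h1 h2 h3] lE.
  exact: GH.
by exists (fun pr => (pr.2, pr.1)) => -[].
Qed.

Lemma vdm_neq0 p : vdm p != 0.
Proof.
rewrite /vdm falt_base; apply/prodf_neq0 => j _; apply/prodf_neq0 => i ij.
rewrite !xptE ypt_diff_neq0 ?tnth_sset // (inj_eq (@tnth_inj _ _ _)).
by rewrite -val_eqE neq_ltn ij.
Qed.

(** The numerator is the product of [y r - y (p j)] over all [r < p j]. Dividing by [vdm p] removes
    the [r] in [lam p]; the others give the edges into [p]. *)
Lemma schub_diag p : schub p p = \prod_(l in Rset lam p) edgeq l p.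
Proof.
rewrite (@big_rset _ _ _ _ _ (fun s s' => ypt p s - ypt p s')); last first.
  by move=> l s s' sp s'p lE; rewrite (edgeq_exchange sp s'p lE).
apply: (mulIf (vdm_neq0 p)); rewrite schub_vdm /faltq falt_point_diag; last first.
  exact: positions_strict.
rewrite big_sset /vdm falt_base -big_split /=; apply: eq_bigr => j _.
rewrite /fpow (big_ord_widen n (fun r => ypt p r - ypt p (positions (lam p) j)));
  last exact/ltnW/positions_lt.
rewrite (bigID (fun s : 'I_n => s \in sset (lam p))) /= mulrC ffunE; congr (_ * _).
rewrite (eq_bigl (fun s : 'I_n =>
  (s \in sset (lam p)) && (s < tnth (lam p) j)%N)); last first.
  by move=> s; rewrite andbC.
rewrite big_mkcondr big_sset -big_mkcond /=; apply: eq_big => [i|i _]; last first.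
  by rewrite !xptE.
have := strict_lt (i := i) (j := j) (positions_strict (lam p)).
have := strict_lt (i := j) (j := i) (positions_strict (lam p)).
rewrite !ffunE; case: (ltngtP i j) => [ij _ /(_ isT)|ij /(_ isT) h _|ij _ _].
- by lia.
- by apply/negbTE; rewrite -leqNgt; lia.
- by rewrite (val_inj ij) ltnn.
Qed.

Lemma varq_homog r : varq r \is 1.-homog.
Proof.
by rewrite /varq; case: insubP => *; rewrite ?dhomog0 // dhomogX; apply/eqP/mdeg1.
Qed.

Lemma Yq_homog p : Yq p \is 1.-homog.
Proof. by apply: rpred_sum => r _; rewrite dhomogX; apply/eqP/mdeg1. Qed.

Lemma ypt_homog p r : ypt p r \is 1.-homog.
Proof. by rewrite rpredB ?varq_homog // dhomogZ // Yq_homog. Qed.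

Lemma tab_homog (y : nat -> A) (x : {ffun 'I_k -> A}) L c C :
  (forall r, y r \is 1.-homog) -> (forall j, x j \is 1.-homog) ->
  tab y L c C x \is (sumn L).-homog.
Proof.
move=> hy hx; elim: L c C => [|l L IH] c C /=; first exact: dhomog1.
apply: rpred_sum => C' /andP[_ /eqP <-]; apply: dhomogM => //.
rewrite /col_weight -sum1_card.
apply: (big_ind2 (fun (f : A) (d : nat) => f \is d.-homog)); first exact: dhomog1.
  by move=> f d g e; apply: dhomogM.
by move=> j _; rewrite rpredB.
Qed.

Lemma schub_homog l p : schub l p \is (sdim (lam l)).-homog.
Proof.
(* Both sides count the boxes of the diagram, by rows and by columns. *)
have -> : sdim (lam l) = sumn (col_sizes (positions (lam l)) n).
  rewrite sumnE big_map -[n in iota _ n]subn0 -/(index_iota 0 n) big_mkord.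
  rewrite (eq_bigr (fun c : 'I_n =>
    \sum_(r < k | (c + r < tnth (lam l) r)%N) 1)%N); last first.
    by move=> c _; rewrite sum1_card; apply: eq_card => r; rewrite !inE ffunE.
  rewrite (exchange_big_dep predT) //=; apply: eq_bigr => r _.
  rewrite -[LHS]card_ord -[LHS]sum1_card (big_ord_widen n (fun=> 1%N)).
    by apply: eq_bigl => c; apply/idP/idP; lia.
  by rewrite (leq_trans (leq_subr _ _)) // ltnW.
by apply: tab_homog => [r|j]; rewrite ?xptE; apply: ypt_homog.
Qed.

Lemma schub_eq0 l p : ~~ bruhat (lam l) (lam p) -> schub l p = 0.
Proof.
move=> h; apply: (mulIf (vdm_neq0 p)); rewrite mul0r schub_vdm /faltq.
apply: falt_point_eq0; try exact: positions_strict.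
by apply: contraNN h => /forallP h; apply/forallP => r; have := h r; rewrite !ffunE.
Qed.

Lemma schub_diag_neq0 p : schub p p != 0.
Proof.
rewrite schub_diag; apply/prodf_neq0 => l /rset_exchange[ss [h1 h2 h3 h4]].
rewrite (edgeq_exchange h1 h2 h4) ypt_diff_neq0 //.
by rewrite -val_eqE neq_ltn h3.
Qed.

Lemma sdim_lt i p : bruhat (lam i) (lam p) -> i != p ->
  (sdim (lam i) < sdim (lam p))%N.
Proof.
move=> /forallP le ne.
have le' r : (tnth (lam i) r - r <= tnth (lam p) r - r)%N by rewrite leq_sub2r.
have [h1 h2] := leqif_sum (fun (r : 'I_k) (_ : true) => leqif_eq (le' r)).
rewrite ltn_neqAle h1 andbT h2; apply: contraNN ne => /forallP h.
apply/eqP/(lam_inj hlam)/positions_inj/ffunP => r; rewrite !ffunE.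
have := eqP (h r); have := strict_ge r (positions_strict (lam i)).
by have := strict_ge r (positions_strict (lam p)); rewrite !ffunE; lia.
Qed.

Lemma rset_lt l p : l \in Rset lam p -> (l < p)%N.
Proof.
move=> lp; have [ss [h1 h2 h3 h4]] := rset_exchange lp.
rewrite ltn_neqAle; apply/andP; split.
  apply/eqP => /val_inj e; move: h4; rewrite e => h4.
  by have := setU11 ss.1 (sset (lam p) :\ ss.2); rewrite -h4 (negbTE h1).
move: lp; rewrite !inE => /existsP[s /existsP[s' /and4P[sl s'l ss' /eqP pE]]].
by apply: (bruhat_le hlam); apply: (exchange_bruhat s'l pE (ltnW ss')).
Qed.

(* A class vanishing below p is divisible at p by every edge into p, hence by
   their product, whose degree is too large. *)
Lemma homog_vanishing (alpha : 'I_m.+1 -> A) i : (0 < n)%N ->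
  (forall l p s s', s \notin sset (lam p) -> s' \in sset (lam p) -> (s < s')%N ->
     sset (lam l) = s |: (sset (lam p) :\ s') ->
     elim_var s (edgeq l p) (alpha p) = elim_var s (edgeq l p) (alpha l)) ->
  (forall p, alpha p != 0 -> bruhat (lam i) (lam p)) ->
  (forall p, alpha p \is (sdim (lam i)).-homog) ->
  alpha i = 0 -> forall p, alpha p = 0.
Proof.
move=> n0 gkm supp hom ai p.
have [N] := ubnP p; elim: N p => // N IH p; rewrite ltnS => pN.
apply/eqP; apply: contraT => nz; have ip := supp p nz.
have ne : i != p by apply: contraNneq nz => <-; rewrite ai.
have hex l : exists ss : 'I_n * 'I_n, l \in Rset lam p ->
  [/\ ss.1 \notin sset (lam p), ss.2 \in sset (lam p), (ss.1 < ss.2)%N &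
      sset (lam l) = ss.1 |: (sset (lam p) :\ ss.2)].
  have [lp|_] := boolP (l \in Rset lam p); last by exists (Ordinal n0, Ordinal n0).
  by have [ss h] := rset_exchange lp; exists ss.
have [ss ssP] := fin_all_exists hex.
have z l : l \in Rset lam p -> elim_var (ss l).1 (edgeq l p) (edgeq l p) = 0.
  by move=> /ssP[h1 h2 _ h4]; apply: (elim_edgeq h1 h2 h4).
have [||||q qE] := @dvd_prod_elim n _ _ (fun l => edgeq l p) (fun l => (ss l).1)
    (alpha p) (enum (Rset lam p)).
- exact: enum_uniq.
- by move=> l; rewrite mem_enum => /z.
- move=> l l'; rewrite !mem_enum => lp l'p ll'.
  have [h1 h2 h3 h4] := ssP l lp; have [h1' h2' h3' h4'] := ssP l' l'p.
  have YE : elim_var (ss l).1 (edgeq l p) (Yq p) = Yq p.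
    rewrite rmorph_sum; apply: eq_bigr => r _ /=; rewrite elim_varX.
    by case: eqP => // e; have := tnth_sset (lam p) r; rewrite e (negbTE h1).
  have ns (u : 'I_n) : u \in sset (lam p) -> (u == (ss l).1) = false.
    by move=> up; apply: contraNF h1 => /eqP <-.
  have EE : elim_var (ss l).1 (edgeq l p) (edgeq l' p) =
      edgeq l' p - (if (ss l').1 == (ss l).1 then edgeq l p else 0).
    rewrite (edgeq_exchange h1' h2' h4') /ypt !varqE.
    rewrite -!mul_mpolyC !rmorphB !rmorphM /= YE !elim_varX (ns _ h2').
    rewrite ![elim_var _ _ _%:MP]comp_mpolyC.
    by case: ifP => _; ring.
  (* If both exchanges insert the same entry, reduction leaves the difference of the shifted
     variables of the two deleted entries; otherwise it leaves the second edge unchanged. *)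
  rewrite EE; case: (eqVneq (ss l').1 (ss l).1) => [e|_].
    rewrite (edgeq_exchange h1' h2' h4') (edgeq_exchange h1 h2 h4) e.
    have -> : forall u v t : A, u - v - (u - t) = t - v by move=> u v t; ring.
    rewrite ypt_diff_neq0 //; apply: contraNneq ll' => e2; apply/eqP.
    by apply: (lam_inj hlam); apply: sset_inj; rewrite h4 h4' e e2.
  by rewrite subr0 (edgeq_exchange h1' h2' h4') ypt_diff_neq0 // -val_eqE neq_ltn h3'.
- move=> l; rewrite mem_enum => lp; have [h1 h2 h3 h4] := ssP l lp.
  rewrite (gkm _ _ _ _ h1 h2 h3 h4).
  by rewrite IH ?rmorph0 // (leq_trans (rset_lt lp)).
rewrite big_enum -schub_diag in qE.
have q0 : q != 0 by apply: contraNneq nz => q0; rewrite qE q0 mul0r.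
have := schub_diag_neq0 p => s0.
have sz (f : A) d : f != 0 -> f \is d.-homog -> msize f = d.+1.
  move=> f0 fd; have := dhomog_uniq f0 fd (dhomog_msize fd).
  by have := msize_poly_eq0 f; rewrite (negbTE f0); lia.
(* [msize] is the degree plus one, so the quotient [q] would have negative degree. *)
have := msizeM q0 s0; rewrite -qE (sz _ _ nz (hom p)) (sz _ _ s0 (schub_homog p p)).
have := sdim_lt ip ne; have := msize_poly_eq0 q; rewrite (negbTE q0).
by lia.
Qed.

Lemma edge_weight_map l p : (l <= p)%N ->
  map_mpoly intr (edge_weight lam b l p) = edgeq l p.
Proof.
move=> lp; have Yi j : map_mpoly intr (Ysum (lam j)) = Yq j.
  by rewrite rmorph_sum; apply: eq_bigr => r _ /=; rewrite map_mpolyX.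
rewrite /edge_weight rmorphB rmorphM /= !Yi rmorph_nat /edgeq; congr (_ - _).
rewrite -mul_mpolyC; congr (_ * _).
rewrite -[in RHS](divnK (weight_dvd hchain lp)) natrM mulfK ?bq_neq0 //.
by rewrite mpolyC_nat.
Qed.

End WeightedPoints.

(** * Integrality and positivity in the given forms *)

Section IntegerPolynomials.
Variable n : nat.

Definition to_rat : {mpoly int[n]} -> {mpoly rat[n]} := map_mpoly intr.

HB.instance Definition _ := GRing.RMorphism.copy to_rat
  (map_mpoly (intr : int -> rat) : {mpoly int[n]} -> {mpoly rat[n]}).

Lemma coef_to_rat P mu : (to_rat P)@_mu = (P@_mu)%:~R.
Proof. exact: mcoeff_map_mpoly. Qed.

Lemma to_rat_inj : injective to_rat.
Proof.
move=> P Q e; apply/mpolyP => mu; apply: (@intr_inj rat).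
by rewrite -!coef_to_rat e.
Qed.

Lemma to_ratX i : to_rat 'X_i = 'X_i.
Proof. exact: map_mpolyX. Qed.

Lemma to_rat_homog d P : P \is d.-homog -> to_rat P \is d.-homog.
Proof.
move=> /dhomogP h; apply/dhomogP => mu.
by rewrite (perm_mem (msupp_map_mpoly _ (@intr_inj rat))); apply: h.
Qed.

Lemma clear_denominators (P : {mpoly rat[n]}) :
  exists N : nat, (0 < N)%N /\ exists P', N%:R *: P = to_rat P'.
Proof.
elim/mpolyind: P => [|c mu P _ _ [N [N0 [P' NP]]]].
  by exists 1%N; split=> //; exists 0; rewrite scaler0 rmorph0.
exists (N * `|denq c|)%N; split; first by rewrite muln_gt0 N0 absz_gt0 denq_neq0.
exists ((N%:Z * numq c) *: 'X_[mu] + denq c *: P').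
rewrite rmorphD /= /to_rat !map_mpolyZ map_mpolyX -/(to_rat P') -NP scalerDr !scalerA.
have dE : (`|denq c|%N%:R : rat) = (denq c)%:~R by rewrite pmulrn absz_denq.
rewrite natrM dE; congr (_ *: _ + _ *: _); last by rewrite mulrC.
by rewrite rmorphM /= numqE -pmulrn; ring.
Qed.

Lemma reduction_eq0 (q : nat) (P : {mpoly int[n]}) : prime q ->
  map_mpoly (intr : int -> 'F_q) P = 0 -> exists P1, P = q%:R *: P1.
Proof.
move=> q_pr P0; exists (\sum_(mu <- msupp P) (P@_mu %/ q%:Z)%Z *: 'X_[mu]).
rewrite scaler_sumr [LHS]mpolyE; apply: eq_bigr => mu _; rewrite scalerA.
congr (_ *: _); rewrite mulrC; apply/esym/eqP; rewrite natz -dvdz_eq.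
rewrite (dvdz_pcharf (pchar_Fp q_pr)) -(mcoeff_map_mpoly (intr : int -> 'F_q)).
by rewrite P0 mcoeff0.
Qed.

(** Remove the primes of [N] one at a time: modulo a prime the polynomials form a domain, and [E] is
    non-zero there since it takes the value 1. *)
Lemma gauss_int (E : {mpoly int[n]}) v N P Q : E.@[v] = 1 -> (0 < N)%N ->
  E * P = N%:R *: Q -> exists P0, P = N%:R *: P0.
Proof.
move=> Ev; have [M] := ubnP N; elim: M N P Q => // M IH N P Q; rewrite ltnS => NM N0.
have [N1 _|N1] := leqP N 1.
  by have -> : N = 1%N by [lia]; exists P; rewrite scale1r.
have q_pr := pdiv_prime N1; set q := pdiv N in q_pr.
have NE : N = (q * (N %/ q))%N by rewrite mulnC divnK // pdiv_dvd.
have q0 : q%:R != 0 :> int by rewrite pnatr_eq0 -lt0n prime_gt0.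
rewrite NE natrM -scalerA => e.
have [|P1 P1E] := @reduction_eq0 q P q_pr.
  have : map_mpoly (intr : int -> 'F_q) (E * P) = 0.
    by rewrite e map_mpolyZ /= rmorph_nat (pcharf0 (pchar_Fp q_pr)) scale0r.
  rewrite rmorphM => /eqP; rewrite mulf_eq0.
  case/orP => [/eqP/(reduction_eq0 q_pr)[E1 EE]|/eqP //].
  have := Ev; rewrite EE mevalZ => /(congr1 absz); rewrite abszM natz absz_nat.
  by move=> /eqP; rewrite muln_eq1 => /andP[/eqP q1 _]; rewrite q1 in q_pr.
have [|||P0 P0E] := IH (N %/ q)%N P1 Q.
- by apply: leq_trans NM; apply: ltn_Pdiv => //; apply: prime_gt1.
- by rewrite divn_gt0 ?prime_gt0 // dvdn_leq // pdiv_dvd.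
- apply/eqP; rewrite -subr_eq0; apply/eqP.
  have /eqP := e; rewrite P1E -scalerAr -subr_eq0 -scalerBr mscalerI (negbTE q0).
  by move=> /eqP.
by exists P0; rewrite P1E P0E scalerA -natrM -NE.
Qed.

Lemma gauss (E Q : {mpoly int[n]}) v (P : {mpoly rat[n]}) : E.@[v] = 1 ->
  to_rat E * P = to_rat Q -> exists P0, P = to_rat P0.
Proof.
move=> Ev e; have [N [N0 [P' NP]]] := clear_denominators P.
have Nq : N%:R != 0 :> rat by rewrite pnatr_eq0 -lt0n.
have toZ (f : {mpoly int[n]}) : to_rat (N%:R *: f) = N%:R *: to_rat f.
  by rewrite /to_rat map_mpolyZ /= rmorph_nat.
have [|P0 P0E] := @gauss_int E v N P' Q Ev N0.
  by apply: to_rat_inj; rewrite rmorphM /= -NP -scalerAr e toZ.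
by exists P0; apply: (scalerI Nq); rewrite NP P0E toZ.
Qed.

End IntegerPolynomials.

Lemma rmorph_mpoly_id n (R : comNzRingType)
    (g : {rmorphism {mpoly R[n]} -> {mpoly R[n]}}) :
  (forall c, g c%:MP = c%:MP) -> (forall i, g 'X_i = 'X_i) -> forall P, g P = P.
Proof.
move=> gC gX P; rewrite [P in LHS]mpolyE [RHS]mpolyE rmorph_sum.
apply: eq_bigr => mu _; rewrite -mul_mpolyC rmorphM /= gC mpolyXE_id rmorph_prod.
by congr (_ * _); apply: eq_bigr => i _; rewrite rmorphXn /= gX.
Qed.

(** * Change of variables to the n forms *)

Section Forms.
Variables (k n m : nat) (lam : 'I_m.+1 -> schubert k n).
Hypotheses (k_gt0 : (0 < k)%N) (k_lt_n : (k < n)%N).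
Hypothesis hlam : schubert_order lam.
Notation A := {mpoly rat[n]}.

Definition psi : {mpoly int[n]} -> {mpoly int[n]} :=
  comp_mpoly [tuple pos_form lam r | r < n].

HB.instance Definition _ := GRing.RMorphism.copy psi
  (comp_mpoly [tuple pos_form lam r | r < n]).

Definition psiq : A -> A :=
  comp_mpoly [tuple of [seq to_rat q | q <- [tuple pos_form lam r | r < n]]].

HB.instance Definition _ := GRing.RMorphism.copy psiq
  (comp_mpoly [tuple of [seq to_rat q | q <- [tuple pos_form lam r | r < n]]]).

Lemma to_rat_psi P : to_rat (psi P) = psiq (to_rat P).
Proof. by apply: map_mpoly_comp; apply: intr_inj. Qed.

Lemma psiqC c : psiq c%:MP = c%:MP.
Proof. exact: comp_mpolyC. Qed.

Let varq := @varq n.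

Let n_gt0 : (0 < n)%N.
Proof. exact: ltn_trans k_lt_n. Qed.

Lemma Yq_lam0 : Yq lam ord0 = \sum_(j < k) varq j.
Proof.
apply: eq_bigr => j _; have /ffunP/(_ j) := positions_lam0 k_lt_n hlam.
by rewrite !ffunE => <-; rewrite /varq varqE.
Qed.

Lemma psiqX (r : 'I_n) : psiq 'X_r = to_rat (pos_form lam r).
Proof. by rewrite [LHS]comp_mpolyXU -tnth_nth !tnth_map tnth_ord_tuple. Qed.

Lemma psiq_varq r : (r.+1 < n)%N -> psiq (varq r) = varq r - varq r.+1.
Proof.
move=> rn; have rn' := ltn_trans (leqnn _) rn.
rewrite (varqE (Ordinal rn) : varq r.+1 = _) (varqE (Ordinal rn') : varq r = _).
by rewrite psiqX /pos_form (insubT (fun x => (x < n)%N) rn) rmorphB /= !to_ratX.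
Qed.

Lemma psiq_last : psiq (varq n.-1) = - \sum_(j < k) varq j.
Proof.
have nn : (n.-1 < n)%N by rewrite prednK.
rewrite -[n.-1]/(val (Ordinal nn)) /varq varqE psiqX.
rewrite /pos_form insubF /=; last by rewrite prednK // ltnn.
rewrite rmorphN -Yq_lam0 rmorph_sum; congr (- _); apply: eq_bigr => r _ /=.
exact: to_ratX.
Qed.

Let tail r : A := \sum_(r <= t < n.-1) varq t.

(** Solving for the last variable: if [z_r] are the forms, then [z_(n-1)] equals minus
    [k y_(n-1) + \sum_(j < k) tail j]. Here the denominator [k] enters. *)
Let theta_last : A := (- k%:R^-1) *: (varq n.-1 + \sum_(j < k) tail j).

Let theta_var (r : nat) : A := theta_last + tail r.

Let theta : A -> A := comp_mpoly [tuple theta_var r | r < n].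

HB.instance Definition _ := GRing.RMorphism.copy theta
  (comp_mpoly [tuple theta_var r | r < n]).

Let thetaX r : (r < n)%N -> theta (varq r) = theta_var r.
Proof.
move=> rn; rewrite -[r in LHS]/(val (Ordinal rn)) /varq varqE.
by rewrite [LHS]comp_mpolyXU -tnth_nth tnth_mktuple.
Qed.

Let kq : k%:R != 0 :> rat.
Proof. by rewrite pnatr_eq0 -lt0n. Qed.

Let tail_diff r : (r < n.-1)%N -> tail r - tail r.+1 = varq r.
Proof. by move=> rn; rewrite /tail big_ltn // addrK. Qed.

Let theta_psiq P : theta (psiq P) = P.
Proof.
apply: (@rmorph_mpoly_id n _ (theta \o psiq)) => [c|i] /=.
  by rewrite psiqC [LHS]comp_mpolyC.
rewrite -varqE -/varq; have [lt|ge] := ltnP i.+1 n.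
  rewrite psiq_varq // rmorphB /= !thetaX // /theta_var.
  by rewrite -[RHS]tail_diff; [ring|lia].
have -> : i = n.-1 :> nat by have := ltn_ord i; lia.
rewrite psiq_last rmorphN rmorph_sum /=.
under eq_bigr => j _ do rewrite thetaX ?(ltn_trans (ltn_ord j)) //.
rewrite big_split /= sumr_const card_ord /theta_last.
rewrite -scaler_nat scalerA mulrN divff // scaleN1r; ring.
Qed.

Let psiq_tail r : (r < n)%N -> psiq (tail r) = varq r - varq n.-1.
Proof.
move=> rn; rewrite rmorph_sum /= big_nat.
rewrite (eq_bigr (fun t => - (varq t.+1 - varq t))) => [|t /andP[_ tn]].
  rewrite -big_nat sumrN telescope_sumr ?opprB //; lia.
by rewrite psiq_varq; [ring|lia].
Qed.

Let psiq_theta P : psiq (theta P) = P.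
Proof.
apply: (@rmorph_mpoly_id n _ (psiq \o theta)) => [c|i] /=.
  by rewrite [theta _]comp_mpolyC psiqC.
rewrite -varqE -/varq thetaX // /theta_var rmorphD /= psiq_tail //.
rewrite /theta_last -mul_mpolyC rmorphM /= psiqC rmorphD /= psiq_last rmorph_sum /=.
have -> : \sum_(j < k) psiq (tail j) = \sum_(j < k) (varq j - varq n.-1).
  by apply: eq_bigr => j _; rewrite psiq_tail // (ltn_trans (ltn_ord j)).
rewrite sumrB sumr_const card_ord addKr mul_mpolyC.
rewrite -scaler_nat scalerN scaleNr opprK scalerA mulVf // scale1r.
by rewrite addrC subrK.
Qed.

Lemma psiq_inj : injective psiq.
Proof. exact: can_inj theta_psiq. Qed.

Lemma psiq_surj f : exists P, f = psiq P.
Proof. by exists (theta f); rewrite psiq_theta. Qed.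

Definition form_int (f : {mpoly int[n]}) : Prop := exists P, f = psi P.

Lemma form_int0 : form_int 0.
Proof. by exists 0; rewrite rmorph0. Qed.

Lemma form_intN f : form_int f -> form_int (- f).
Proof. by move=> [P ->]; exists (- P); rewrite rmorphN. Qed.

Lemma form_intD f g : form_int f -> form_int g -> form_int (f + g).
Proof. by move=> [P ->] [Q ->]; exists (P + Q); rewrite rmorphD. Qed.

Lemma form_intM f g : form_int f -> form_int g -> form_int (f * g).
Proof. by move=> [P ->] [Q ->]; exists (P * Q); rewrite rmorphM. Qed.

Lemma form_int_nat d : form_int d%:R.
Proof. by exists d%:R; rewrite rmorph_nat. Qed.

Lemma form_int_sum (I : finType) (Q : pred I) (F : I -> {mpoly int[n]}) :
  (forall i, Q i -> form_int (F i)) -> form_int (\sum_(i | Q i) F i).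
Proof.
by move=> h; apply: (big_ind form_int); [exact: form_int0|exact: form_intD|].
Qed.

(* A linear form taking the value 1 at an integer point is primitive. *)
Lemma form_int_div e f v : e.@[v] = 1 -> form_int e -> form_int (e * f) ->
  form_int f.
Proof.
move=> ev [E eE] [Q efE]; have [P PE] := psiq_surj (to_rat f).
(* As a polynomial in the forms, [e] takes the value 1 at the integer point whose coordinates are
   the values of the forms at [v]. *)
have [||P0 P0E] := @gauss n E Q (fun i => (tnth [tuple pos_form lam r | r < n] i).@[v]) P.
- by rewrite -comp_mpoly_meval -/(psi E) -eE.
- by apply: psiq_inj; rewrite rmorphM /= -to_rat_psi -eE -PE -to_rat_psi -efE rmorphM.
by exists P0; apply: to_rat_inj; rewrite to_rat_psi -P0E.
Qed.

Definition form_pos (f : A) : Prop :=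
  exists2 P : A, (forall mu, 0 <= P@_mu) & f = psiq P.

Lemma form_pos0 : form_pos 0.
Proof. by exists 0; rewrite ?rmorph0 // => mu; rewrite mcoeff0. Qed.

Lemma form_posC c : 0 <= c -> form_pos c%:MP.
Proof.
move=> c0; exists c%:MP; rewrite ?psiqC // => mu.
by rewrite mcoeffC mulr_ge0 // ler0n.
Qed.

Lemma form_posD f g : form_pos f -> form_pos g -> form_pos (f + g).
Proof.
move=> [P P0 ->] [Q Q0 ->]; exists (P + Q); rewrite ?rmorphD // => mu.
by rewrite mcoeffD addr_ge0.
Qed.

Lemma form_posM f g : form_pos f -> form_pos g -> form_pos (f * g).
Proof.
move=> [P P0 ->] [Q Q0 ->]; exists (P * Q); rewrite ?rmorphM // => mu.
by rewrite mcoeffM; apply: sumr_ge0 => i _; apply: mulr_ge0.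
Qed.

Lemma form_pos_sum (I : finType) (Q : pred I) (F : I -> A) :
  (forall i, Q i -> form_pos (F i)) -> form_pos (\sum_(i | Q i) F i).
Proof.
by move=> h; apply: (big_ind form_pos); [exact: form_pos0|exact: form_posD|].
Qed.

Lemma form_pos_var (r : 'I_n) : form_pos (psiq 'X_r).
Proof. by exists 'X_r => // mu; rewrite mcoeffX ler0n. Qed.

Lemma form_pos_diff i e : (i <= e)%N -> (e < n)%N -> form_pos (varq i - varq e).
Proof.
move=> ie; rewrite -(subnKC ie); elim: (e - i)%N => [|d IH] dn.
  by rewrite addn0 subrr; apply: form_pos0.
have -> : varq i - varq (i + d.+1) =
    (varq i - varq (i + d)%N) + (varq (i + d)%N - varq (i + d).+1).
  by rewrite addnS; ring.
have dn' : (i + d < n)%N by lia.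
apply: form_posD; first exact: IH.
rewrite -psiq_varq; last by rewrite -addnS.
by rewrite -[(i + d)%N]/(val (Ordinal dn')) /varq varqE; apply: form_pos_var.
Qed.

Lemma form_posNY l : form_pos (- Yq lam l).
Proof.
have -> : - Yq lam l = - Yq lam ord0 + \sum_(j < k) (varq j - varq (tnth (lam l) j)).
  rewrite sumrB -Yq_lam0 addrA addNr add0r; congr (- _).
  by apply: eq_bigr => j _; rewrite /varq varqE.
apply: form_posD; last first.
  apply: form_pos_sum => j _; apply: form_pos_diff => //.
  by have := strict_ge j (positions_strict (lam l)); rewrite ffunE.
rewrite Yq_lam0 -psiq_last; have nn : (n.-1 < n)%N by rewrite prednK.
by rewrite -[n.-1]/(val (Ordinal nn)) /varq varqE; apply: form_pos_var.
Qed.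

Lemma form_int_diff i e : (i <= e)%N -> forall (en : (e < n)%N) (inn : (i < n)%N),
  form_int ('X_(Ordinal inn) - 'X_(Ordinal en)).
Proof.
move=> ie; have [d dE] : exists d, (e = i + d)%N by exists (e - i)%N; lia.
elim: d e dE {ie} => [|d IH] e dE en inn.
  have -> : Ordinal en = Ordinal inn by apply: val_inj; rewrite /= dE addn0.
  by rewrite subrr; apply: form_int0.
have dn : (i + d < n)%N by lia.
have -> : 'X_(Ordinal inn) - 'X_(Ordinal en) = ('X_(Ordinal inn) - 'X_(Ordinal dn))
    + ('X_(Ordinal dn) - 'X_(Ordinal en)) :> {mpoly int[n]} by ring.
apply: form_intD; first exact: IH.
exists 'X_(Ordinal dn); rewrite [RHS]comp_mpolyXU -tnth_nth tnth_mktuple.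
have en' : ((i + d).+1 < n)%N by rewrite -addnS -dE.
rewrite /pos_form (insubT (fun x => (x < n)%N) en') /=.
by have -> : Ordinal en = Ordinal en' by apply: val_inj; rewrite /= dE addnS.
Qed.

Lemma form_intY l : form_int (Ysum (lam l)).
Proof.
have nn : (n.-1 < n)%N by rewrite prednK.
have Y0 : form_int (Ysum (lam ord0)).
  rewrite -[Ysum _]opprK; apply: form_intN; exists 'X_(Ordinal nn).
  rewrite [RHS]comp_mpolyXU -tnth_nth tnth_mktuple /pos_form insubF //=.
  by rewrite prednK // ltnn.
have -> : Ysum (lam l) = Ysum (lam ord0)
    - \sum_(j < k) ('X_(tnth (lam ord0) j) - 'X_(tnth (lam l) j)).
  by rewrite sumrB opprB addrCA addrN addr0.
apply: form_intD => //; apply/form_intN/form_int_sum => j _.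
case E0: (tnth (lam ord0) j) => [u un]; case E1: (tnth (lam l) j) => [v vn].
apply: form_int_diff.
have /ffunP/(_ j) := positions_lam0 k_lt_n hlam; rewrite !ffunE E0 /= => ->.
by have := strict_ge j (positions_strict (lam l)); rewrite ffunE E1.
Qed.

End Forms.

(** * Structure constants *)

Section StructureConstants.
Variables (k n m : nat) (lam : 'I_m.+1 -> schubert k n) (b : 'I_m.+1 -> nat).
Hypotheses (k_gt0 : (0 < k)%N) (k_lt_n : (k < n)%N).
Hypotheses (hlam : schubert_order lam) (hb : plucker_weight lam b).
Hypothesis hchain : div_chain b.
Variable w : nat -> rat.
Hypothesis hw : forall i, (b i)%:R = \sum_(r < k) w (tnth (lam i) r).
Hypothesis w_anti : forall i e, (i <= e)%N -> (e < n)%N -> w e <= w i.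
Notation A := {mpoly rat[n]}.
Implicit Types (l p : 'I_m.+1).

Let Y := Yq lam.
Let yp p := ypt lam b w p.
Let xp p := xpt lam b w p.
Let sch := schub lam b w.
Let fa := faltq lam b w.

(** The coefficients [q l] are the same at all fixed points, so the expansion is one in cohomology
    classes once [vdm p] is cancelled. *)
Let cone (h : 'I_m.+1 -> A) : Prop := exists q : 'I_m.+1 -> A,
  (forall l, form_pos lam (q l)) /\ forall p, h p = \sum_l q l * fa l p.

Let cone_ext h h' : (forall p, h p = h' p) -> cone h -> cone h'.
Proof. by move=> e [q [q0 hq]]; exists q; split=> // p; rewrite -e. Qed.

Let cone0 : cone (fun=> 0).
Proof.
exists (fun=> 0); split=> [l|p]; first exact: form_pos0.
by rewrite big1 // => l _; rewrite mul0r.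
Qed.

Let coneD h h' : cone h -> cone h' -> cone (fun p => h p + h' p).
Proof.
move=> [q [q0 hq]] [q' [q'0 hq']]; exists (fun l => q l + q' l); split=> [l|p].
  exact: form_posD.
by rewrite hq hq' -big_split; apply: eq_bigr => l _; rewrite mulrDl.
Qed.

Let coneZ c h : form_pos lam c -> cone h -> cone (fun p => c * h p).
Proof.
move=> c0 [q [q0 hq]]; exists (fun l => c * q l); split=> [l|p].
  exact: form_posM.
by rewrite hq mulr_sumr; apply: eq_bigr => l _; rewrite mulrA.
Qed.

Let cone_sum (I : finType) (h : I -> 'I_m.+1 -> A) :
  (forall i, cone (h i)) -> cone (fun p => \sum_i h i p).
Proof.
move=> hQ; elim: (index_enum I) => [|i r IH] /=.
  by apply: cone_ext cone0 => p; rewrite big_nil.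
by apply: cone_ext (coneD (hQ i) IH) => p; rewrite big_cons.
Qed.

Let xpE p (j : 'I_k) : exists2 r, (r < n)%N & xp p j = yp p r.
Proof. by exists (tnth (lam p) j); rewrite // /xp xptE. Qed.

Let cone_fa l : cone (fa l).
Proof.
exists (fun l' => (l' == l)%:R%:MP); split=> [l'|p].
  by apply: form_posC; rewrite ler0n.
rewrite (bigD1 l) //= eqxx mpolyC1 mul1r big1 ?addr0 // => l' ne.
by rewrite (negbTE ne) mpolyC0 mul0r.
Qed.

Let cone_falt (a : {ffun 'I_k -> nat}) : strict a ->
  cone (fun p => falt (yp p) a (xp p)).
Proof.
move=> sa; have [/forallP an|an] := boolP [forall j : 'I_k, (a j < n)%N].
  have [l <-] := lam_positions hlam sa an; exact: cone_fa.
by apply: cone_ext cone0 => p; rewrite (falt_range_eq0 (@xpE p) an).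
Qed.

Let cone_raise l (j : 'I_k) :
  cone (fun p => falt (yp p) (raise (positions (lam l)) [set j]) (xp p)).
Proof.
have sl := positions_strict (lam l).
have [|ns] := boolP (strict (raise (positions (lam l)) [set j])).
  exact: cone_falt.
have [i [i' [ii' _ e]]] := raise_not_strict sl ns.
apply: cone_ext cone0 => p; rewrite (@falt_eq0 _ _ _ _ _ i i') //.
by rewrite -val_eqE /= ii'; lia.
Qed.

(* Multiplication by -Y_p / b_p is controlled by the weighted equivariant
   Chevalley formula. *)
Let cone_diff_fa l i e : (i <= e)%N -> (e < n)%N ->
  cone (fun p => (yp p i - yp p e) * fa l p).
Proof.
move=> ie en; set t := (w i - w e) / (b l)%:R.
have t0 : 0 <= t by rewrite divr_ge0 ?ler0n // subr_ge0 w_anti.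
(* Here [- ((w i - w e) / b p) Y_p] is [t] times [edgeq l p - Y l], and the product of the edge form
   with [fa l p] is the sum of the raised alternants. *)
apply: (@cone_ext (fun p => (varq n i - varq n e + t%:MP * - Y l) * fa l p +
   t%:MP * \sum_j falt (yp p) (raise (positions (lam l)) [set j]) (xp p))).
  move=> p; rewrite -fpow_diff_sum.
  have -> : \sum_j yp p (positions (lam l) j) = edgeq lam b l p.
    by rewrite -(sum_ypt hw); apply: eq_bigr => j _; rewrite ffunE.
  have -> : \sum_j xp p j = 0 by apply: (sum_xpt hb hw).
  rewrite subr0 -[falt _ _ _]/(fa l p) /yp /ypt /edgeq -/(Y l) -/(Y p) mulrDl.
  rewrite -!mul_mpolyC.
  have -> : (w i / (b p)%:R)%:MP_[n] =
      (w e / (b p)%:R)%:MP + t%:MP * ((b l)%:R / (b p)%:R)%:MP.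
    rewrite -mpolyCM -mpolyCD; congr _%:MP.
    rewrite /t mulrA divfK; last by rewrite pnatr_eq0 -lt0n (weight_gt0 hb).
    by rewrite -mulrDl addrC subrK.
  by ring.
apply: coneD; apply: coneZ.
- apply: form_posD; first exact: form_pos_diff.
  by apply: form_posM; [apply: form_posC|apply: form_posNY].
- exact: cone_fa.
- exact: form_posC.
- by apply: cone_sum => j; apply: cone_raise.
Qed.

Let cone_diff i e h : (i <= e)%N -> (e < n)%N -> cone h ->
  cone (fun p => (yp p i - yp p e) * h p).
Proof.
move=> ie en [q [q0 hq]].
apply: (@cone_ext (fun p => \sum_l q l * ((yp p i - yp p e) * fa l p))).
  by move=> p; rewrite hq mulr_sumr; apply: eq_bigr => l _; ring.
by apply: cone_sum => l; apply: coneZ => //; apply: cone_diff_fa.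
Qed.

(** Expand the tableau sum of [i] times the alternant of [j], then cancel [vdm p]. *)
Lemma schub_mul_pos i j : exists q : 'I_m.+1 -> A,
  (forall l, form_pos lam (q l)) /\
  forall p, schub lam b w i p * schub lam b w j p =
    \sum_l q l * schub lam b w l p.
Proof.
have [q [q0 hq]] : cone (fun p => sch i p * fa j p).
  apply: (@cone_tab_falt _ _ n _ yp xp xpE cone cone_ext cone0 coneD).
  - by move=> *; apply: cone_diff.
  - by move=> a sa _; apply: cone_falt.
  - exact: positions_strict.
exists q; split=> // p; apply: (mulIf (vdm_neq0 lam b w p)).
rewrite -mulrA schub_vdm hq mulr_suml; apply: eq_bigr => l _.
by rewrite -mulrA schub_vdm.
Qed.

(** The matrix of restrictions is triangular for the total order, with non-zero diagonal. *)
Lemma schub_free (q : 'I_m.+1 -> A) :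
  (forall p, \sum_l q l * schub lam b w l p = 0) -> forall l, q l = 0.
Proof.
move=> h p; have [N] := ubnP p; elim: N p => // N IH p; rewrite ltnS => pN.
have := h p; rewrite (bigD1 p) //= big1 ?addr0 => [/eqP|l lp].
  by rewrite mulf_eq0 (negbTE (schub_diag_neq0 hlam hb hw p)) orbF => /eqP.
have [lep|nle] := boolP (bruhat (lam l) (lam p)); last by rewrite schub_eq0 ?mulr0.
have lt : (l < p)%N by rewrite ltn_neqAle lp (bruhat_le hlam).
by rewrite IH ?mul0r // (leq_trans lt).
Qed.

(** * Schubert classes and the integrality of their structure constants *)

Section Classes.
Variable S : 'I_m.+1 -> 'I_m.+1 -> {mpoly int[n]}.
Hypothesis hS : forall i, is_schubert_class lam b i (S i).

(** The difference of the two families meets the edge conditions, the support and degree bounds, and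
    is zero at [i]; hence it vanishes everywhere. *)
Lemma schubert_class_schub i p : to_rat (S i p) = schub lam b w i p.
Proof.
have [hHT hsupp hdiag hhom] := hS i.
apply/eqP; rewrite -subr_eq0; apply/eqP; move: p.
apply: (homog_vanishing hlam hb hw (i := i) (ltn_trans k_gt0 k_lt_n)).
- move=> l p s s' sp s'p ss' lE; have lp := exchange_rset sp s'p ss' lE.
  have [q qE] := hHT l p lp.
  have gS : elim_var s (edgeq lam b l p) (to_rat (S i p)) =
      elim_var s (edgeq lam b l p) (to_rat (S i l)).
    apply/eqP; rewrite -subr_eq0 -!rmorphB /= qE !rmorphM /=.
    have le := ltnW (rset_lt hlam lp).
    rewrite [to_rat (edge_weight _ _ _ _)](edge_weight_map hb hchain le).
    by rewrite (elim_edgeq hb hw sp s'p lE) mulr0.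
  by rewrite !rmorphB /= (elim_schub hb hw sp s'p lE) gS.
- move=> p; apply: contraNT => nle; rewrite schub_eq0 // subr0.
  have [->|/hsupp] := eqVneq (S i p) 0; first by rewrite rmorph0.
  by rewrite (negbTE nle).
- by move=> p; rewrite rpredB ?to_rat_homog ?schub_homog.
rewrite hdiag schub_diag // rmorph_prod; apply/eqP; rewrite subr_eq0; apply/eqP.
apply: eq_bigr => l lp /=; apply: edge_weight_map => //.
exact/ltnW/(rset_lt hlam lp).
Qed.

Lemma edge_primitive l p : l != p ->
  exists v, (edge_weight lam b l p).@[v] = 1.
Proof.
move=> ne; have [s sl sp] : exists2 s, s \in sset (lam l) & s \notin sset (lam p).
  apply/subsetPn; apply: contraNN ne => sub; apply/eqP/(lam_inj hlam)/sset_inj.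
  by apply/eqP; rewrite eqEcard sub !card_sset leqnn.
(* The indicator of an entry of [lam l] missing from [lam p] gives [Y_l] the value 1 and [Y_p] the
   value 0. *)
pose v (x : 'I_n) : int := (x == s)%:R.
have YE q : (Ysum (lam q)).@[v] = (s \in sset (lam q))%:R.
  rewrite /Ysum raddf_sum /=; under eq_bigr do rewrite mevalXU.
  rewrite -(big_sset _ (lam q) v) /v; have [sq|sq] := boolP (s \in _).
    rewrite (bigD1 s) //= eqxx big1 ?addr0 // => x /andP[_ ne'].
    by rewrite (negbTE ne').
  rewrite big1 // => x xq; case: eqP => // e.
  by rewrite -e xq in sq.
by exists v; rewrite mevalB mevalM !YE sl (negbTE sp) mulr0 subr0.
Qed.

Lemma form_int_edge l p : form_int lam (edge_weight lam b l p).
Proof.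
apply: form_intD; first exact: form_intY.
by apply/form_intN/form_intM; [exact: form_int_nat|exact: form_intY].
Qed.

Lemma form_int_diag p : form_int lam (S p p).
Proof.
have [_ _ -> _] := hS p; apply: (big_ind (form_int lam)).
- exact: (form_int_nat lam 1).
- exact: form_intM.
- by move=> l _; apply: form_int_edge.
Qed.

Lemma form_int_div_diag p f : form_int lam (S p p * f) -> form_int lam f.
Proof.
have [_ _ -> _] := hS p; rewrite -big_enum.
have : all (fun l => l != p) (enum (Rset lam p)).
  by apply/allP => l; rewrite mem_enum => /(rset_lt hlam) lp; rewrite -val_eqE neq_ltn lp.
elim: (enum _) f => [|l r IH] f /=; first by rewrite big_nil mul1r.
case/andP=> lp hr; rewrite big_cons -mulrA => h; apply: (IH _ hr).
have [v ev] := edge_primitive lp.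
by apply: (form_int_div k_gt0 k_lt_n hlam ev) h; apply: form_int_edge.
Qed.

(** The one-box Pieri rule after cancelling [vdm p]. Raised exponents that collide or reach [n] have
    zero alternant and match empty inner sums. *)
Lemma chevalley l p : (l <= p)%N -> edge_weight lam b l p * S l p =
  \sum_(j < k) \sum_(l' | positions (lam l') == raise (positions (lam l)) [set j])
     S l' p.
Proof.
move=> lp; apply: to_rat_inj; rewrite rmorphM rmorph_sum /=.
rewrite [to_rat (edge_weight _ _ _ _)](edge_weight_map hb hchain) //.
rewrite schubert_class_schub; apply: (mulIf (vdm_neq0 lam b w p)).
rewrite -mulrA schub_vdm mulr_suml.
have := fpow_diff_sum (ypt lam b w p) (positions (lam l)) (xpt lam b w p).
rewrite (sum_xpt hb hw) subr0.
have -> : \sum_j ypt lam b w p (positions (lam l) j) = edgeq lam b l p.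
  by rewrite -(sum_ypt hw); apply: eq_bigr => j _; rewrite ffunE.
move=> ->; apply: eq_bigr => j _; rewrite rmorph_sum /= mulr_suml.
set a := raise _ _.
have [sa|nsa] := boolP (strict a); last first.
  have [i [i' [ii' _ e]]] := raise_not_strict (positions_strict _) nsa.
  rewrite (@falt_eq0 _ _ _ _ _ i i') //; last by rewrite -val_eqE /= ii'; lia.
  rewrite big_pred0 // => l'; apply: contraNF nsa => /eqP <-.
  exact: positions_strict.
have [/forallP an|nan] := boolP [forall j : 'I_k, (a j < n)%N].
  have [l1 l1E] := lam_positions hlam sa an.
  rewrite (big_pred1 l1) => [|l'].
    by rewrite schubert_class_schub schub_vdm /faltq l1E.
  by rewrite -l1E (inj_eq (@positions_inj _ _)) (inj_eq (lam_inj hlam)).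
rewrite (falt_range_eq0 (@xpE p) nan) big_pred0 // => l'.
apply: contraNF nan => /eqP <-; apply/forallP => i; exact: positions_lt.
Qed.

(** Descending induction on [l]: the Chevalley formula expresses the edge form times [S l p] by
    classes of larger index, and the edge form is primitive. *)
Lemma form_int_class l p : form_int lam (S l p).
Proof.
have [N] := ubnP (m.+1 - l)%N; elim: N l => // N IH l; rewrite ltnS => lN.
have [->|ne] := eqVneq l p; first exact: form_int_diag.
have [->|nz] := eqVneq (S l p) 0; first exact: form_int0.
have [_ hsupp _ _] := hS l; have lp := bruhat_le hlam (hsupp p nz).
have [v ev] := edge_primitive ne.
apply: (form_int_div k_gt0 k_lt_n hlam ev); first exact: form_int_edge.
rewrite chevalley //; apply: form_int_sum => j _; apply: form_int_sum => l' /eqP l'E.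
apply: IH; suff : (l < l')%N by have := ltn_ord l'; lia.
have [e1 e2 e3] := positions_raise l'E.
rewrite ltn_neqAle; apply/andP; split.
  by apply/eqP => /val_inj ll'; move: e1; rewrite -ll'; lia.
by apply: (bruhat_le hlam); apply: (exchange_bruhat e2 e3); rewrite e1.
Qed.

Variable C : 'I_m.+1 -> 'I_m.+1 -> 'I_m.+1 -> {mpoly int[n]}.
Hypothesis hC : is_structure_constants S C.

(** Ascending induction on [l]: restricting the product to the fixed point [l] leaves only constants
    of smaller index besides [S l l * C i j l]. *)
Lemma form_int_constant i j l : form_int lam (C i j l).
Proof.
have [N] := ubnP l; elim: N l => // N IH l; rewrite ltnS => lN.
apply: (@form_int_div_diag l).
have -> : S l l * C i j l = S i l * S j l - \sum_(l' | l' != l) C i j l' * S l' l.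
  by rewrite hC (bigD1 l) //= addrK mulrC.
apply: form_intD; first by apply: form_intM; apply: form_int_class.
apply/form_intN/form_int_sum => l' ne.
have [->|nz] := eqVneq (S l' l) 0; first by rewrite mulr0; apply: form_int0.
have [_ hsupp _ _] := hS l'; have le := bruhat_le hlam (hsupp l nz).
apply: form_intM; last exact: form_int_class.
by apply: IH; apply: leq_trans lN; rewrite ltn_neqAle ne.
Qed.

Lemma form_pos_constant i j l : form_pos lam (to_rat (C i j l)).
Proof.
have [q [q0 hq]] := schub_mul_pos i j.
suff -> : to_rat (C i j l) = q l by [].
apply/eqP; rewrite -subr_eq0; apply/eqP.
apply: (@schub_free (fun l => to_rat (C i j l) - q l)) => p.
rewrite (eq_bigr (fun l => to_rat (C i j l * S l p) - q l * schub lam b w l p)).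
  by rewrite sumrB -hq -rmorph_sum /= -hC rmorphM /= !schubert_class_schub subrr.
by move=> l' _; rewrite mulrBl rmorphM /= schubert_class_schub.
Qed.

(** The forms are algebraically independent over the rationals, so the integral and the non-negative
    expressions are the same polynomial. *)
Lemma pos_poly_constant i j l : pos_poly lam (C i j l).
Proof.
have [P CE] := form_int_constant i j l.
have [Q Q0] := form_pos_constant i j l; rewrite CE to_rat_psi.
move=> /(psiq_inj k_gt0 k_lt_n hlam) QE; exists P; split=> [mu|//].
by rewrite -(ler0z rat) -coef_to_rat QE.
Qed.

End Classes.
End StructureConstants.

Local Close Scope ring_scope.

(* S i p is the restriction of the i-th Schubert class at the p-th fixed point;
   the complex numbers are R[i] with R the real numbers. *)
Theorem theorem5p14 (R : realType) (k n m : nat)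
  (hk : (1 <= k)%N) (hkn : (k < n)%N) (hm : m.+1 = 'C(n, k))
  (lam : 'I_m.+1 -> schubert k n) (hlam : schubert_order lam)
  (b : 'I_m.+1 -> nat) (hb : plucker_weight lam b)
  (hdiv : divisive lam R[i] b) (hchain : div_chain b)
  (S : 'I_m.+1 -> 'I_m.+1 -> {mpoly int[n]})
  (hS : forall i : 'I_m.+1, is_schubert_class lam b i (S i))
  (C : 'I_m.+1 -> 'I_m.+1 -> 'I_m.+1 -> {mpoly int[n]})
  (hC : is_structure_constants S C) :
  forall i j l : 'I_m.+1, pos_poly lam (C i j l).
Proof.
move=> i j l; have [w [hw w_anti]] := weight_split hk hkn hlam hb hchain.
exact: (pos_poly_constant hk hkn hlam hb hchain hw w_anti hS hC).
Qed.
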